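(* Let $(x_k,y_k)\in\mathbb{Z}^d\times\mathbb{Z}^d$ $(1\le k\le L-1)$ and $(\alpha,\beta)\in(\mathbb{R}^d\times\mathbb{R}^d)\setminus(\mathbb{Z}^d\times\mathbb{Z}^d)$, and assume that $0\ne f\in\mathcal{S}(\mathbb{R}^d)$ and $c_1,\dots,c_{L-1}\in\mathbb{C}$ satisfy $$\sum_{k=1}^{L-1}c_kM_{y_k}T_{x_k}f=M_\beta T_\alpha f.\qquad( * )$$ Let $\gamma=(-\alpha,\beta)$ and assume that $H=\overline{\{n\gamma\bmod\mathbb{Z}^{2d}:n\in\mathbb{Z}\}}\subset\mathbb{T}^{2d}$ is infinite and proper. Let $H_0$ be the identity component of $H$, $m=|H/H_0|$, $r=\dim H_0$, let $\Phi:H_0\to\mathbb{T}^r$ be a Lie group isomorphism, and set $\omega:=\Phi(m\gamma)\in\mathbb{T}^r$. Fix $\lambda\in S$ and let $b_\lambda(x):=\log Q_m(\lambda+\Phi^{-1}(x))$ for $x\in\mathbb{T}^r$. Then for every integer $N\ge0$, $$\sup_{k\in\mathbb{Z}^r\setminus\{0\}}(1+|k|)^N\frac{|\widehat b_\lambda(k)|}{|e^{2\pi i\langle k,\omega\rangle}-1|}<\infty.$$ Equivalently, for every integer $N\ge0$, $$\sup_{k\in\mathbb{Z}^r\setminus\{0\}}(1+|k|)^N\frac{|\widehat b_\lambda(k)|}{\|\langle k,\omega\rangle\|_{\mathbb{T}}}<\infty,$$ where $\|t\|_{\mathbb{T}}:=\inf_{n\in\mathbb{Z}}|t-n|$. In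 particular, if there exist $N\ge0$ and a sequence $k_n\in\mathbb{Z}^r\setminus\{0\}$ such that $$(1+|k_n|)^N\frac{|\widehat b_\lambda(k_n)|}{\|\langle k_n,\omega\rangle\|_{\mathbb{T}}}\longrightarrow\infty,$$ then no nonzero Schwartz window $f$ can satisfy $( * )$ (that is, such $N$ and $(k_n)$ are incompatible with the assumptions above).
   Context: Here $d\ge1$, $L\ge2$ are integers, $\langle\cdot,\cdot\rangle$ is the standard inner product, $\mathcal{S}(\mathbb{R}^d)$ is the Schwartz space, and $\mathbb{T}^n=\mathbb{R}^n/\mathbb{Z}^n$; periodic functions on $\mathbb{R}^n$ are identified with functions on $\mathbb{T}^n$, and vectors of $\mathbb{R}^{2d}$ act on $\mathbb{T}^{2d}$ by translation modulo $\mathbb{Z}^{2d}$. Time-frequency shifts: $T_xf(t)=f(t-x)$, $M_yf(t)=e^{-2\pi i\langle y,t\rangle}f(t)$. Zak transform: $Zf(t,\xi)=\sum_{\kappa\in\mathbb{Z}^d}e^{-2\pi i\langle\xi,\kappa\rangle}f(t+\kappa)$ on $\mathbb{R}^d\times\mathbb{R}^d$. Its modulus is $\mathbb{Z}^{2d}$-periodic and continuous; $S:=\{z\in\mathbb{T}^{2d}:Zf(z)\ne0\}$. $p(t,\xi):=\sum_{k=1}^{L-1}c_ke^{-2\pi i\langle y_k,t\rangle}e^{-2\pi i\langle\xi,x_k\rangle}$, regarded as a function on $\mathbb{T}^{2d}$, and $Q_m(z):=\prod_{j=0}^{m-1}|p(z+j\gamma)|$ for $z\in\mathbb{T}^{2d}$.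 $H$ is a closed subgroup of $\mathbb{T}^{2d}$, hence a compact abelian Lie group; ''proper'' means $H\ne\mathbb{T}^{2d}$. $H_0$ is a torus, $H/H_0$ is finite cyclic generated by the class of $\gamma$, and the class of $m\gamma$ lies in $H_0$. Fourier coefficients: $\widehat g(k)=\int_{\mathbb{T}^r}g(x)e^{-2\pi i\langle k,x\rangle}\,dx$, $k\in\mathbb{Z}^r$; $|k|$ is the Euclidean norm. *)

(* Defs.v *)
From HB Require Import structures.
From mathcomp Require Import all_boot all_order all_algebra.
From mathcomp Require Import generic_quotient ring_quotient.
From mathcomp Require Import all_classical all_reals all_analysis.
From mathcomp Require summability.
From mathcomp Require Import complex.

Set Implicit Arguments.
Unset Strict Implicit.
Unset Printing Implicit Defensive.

Import Order.TTheory GRing.Theory Num.Theory.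
Import numFieldNormedType.Exports.

Local Open Scope classical_set_scope.
Local Open Scope ring_scope.
Local Open Scope complex_scope.

Definition dotp (R : realType) (n : nat) (u v : 'rV[R]_n) : R :=
  \sum_(i < n) u 0 i * v 0 i.

Definition intv (R : realType) (n : nat) (k : 'rV[int]_n) : 'rV[R]_n :=
  map_mx intr k.

Definition eucl_norm (R : realType) (n : nat) (u : 'rV[R]_n) : R :=
  Num.sqrt (dotp u u).

(* [e2pi t] is exp (2 pi i t). *)
Definition e2pi (R : realType) (t : R) : R[i] :=
  cos (2 * pi * t) +i* sin (2 * pi * t).

(* The modulus with values in [R]; MathComp's [`|z|] lives in [R[i]]. *)
Definition cmod (R : realType) (z : R[i]) : R := Normc.normc z.

Definition dist_int (R : realType) (t : R) : R :=
  inf [set `|t - n%:~R| | n in [set: int]].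

Definition intvec (R : realType) (n : nat) : {pred 'rV[R]_n} :=
  fun x : 'rV[R]_n => [forall i : 'I_n, x 0 i \is a Num.int].

Lemma intvec_zmod_closed (R : realType) (n : nat) : zmod_closed (@intvec R n).
Proof.
split=> [|x y /forallP xZ /forallP yZ].
  by apply/forallP => i; rewrite mxE rpred0.
by apply/forallP => i; rewrite !mxE rpredB.
Qed.

HB.instance Definition _ (R : realType) (n : nat) :=
  GRing.isZmodClosed.Build 'rV[R]_n (@intvec R n) (@intvec_zmod_closed R n).

Definition torus (R : realType) (n : nat) : Type :=
  quotient_topology (Quotient.quot (@intvec R n)).

HB.instance Definition _ (R : realType) (n : nat) :=
  Topological.on (torus R n).
HB.instance Definition _ (R : realType) (n : nat) :=
  Quotient.on (torus R n).
HB.instance Definition _ (R : realType) (n : nat) :=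
  GRing.Zmodule.copy (torus R n) (Quotient.quot (@intvec R n)).

Definition to_torus (R : realType) (n : nat) (x : 'rV[R]_n) : torus R n :=
  (\pi_(torus R n) x)%qT.

(* A Z^n-periodic function on R^n, seen on the torus through the choice of
   representatives [repr]; by periodicity the choice is immaterial. *)
Definition on_torus (R : realType) (n : nat) (T : Type) (g : 'rV[R]_n -> T)
  : torus R n -> T := fun z => g (repr z).

(* <k, w> for w on the torus: only defined modulo 1, and only used below inside
   the 1-periodic functions [e2pi] and [dist_int]. *)
Definition tpair (R : realType) (r : nat) (k : 'rV[int]_r) (w : torus R r) : R :=
  on_torus (dotp (intv R k)) w.

(* For a subgroup [A] of the torus: [Phi] and [Psi] are mutually inverse
   isomorphisms of topological groups between [A] and the r-torus.  For closed
   subgroups this is the same as an isomorphism of Lie groups, since continuous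
   homomorphisms of Lie groups are smooth.  In particular r is the
   dimension of [A].  Values of [Phi] outside [A] play no role. *)
Definition torus_iso (R : realType) (n r : nat) (A : set (torus R n))
    (Phi : torus R n -> torus R r) (Psi : torus R r -> torus R n) : Prop :=
  [/\ {within A, continuous Phi},
      continuous Psi,
      (forall z w, A z -> A w -> Phi (z + w) = Phi z + Phi w),
      (forall x, A (Psi x) /\ Phi (Psi x) = x) &
      (forall z, A z -> Psi (Phi z) = z)].

Definition cosets (R : realType) (n : nat) (H H0 : set (torus R n)) :
    set (set (torus R n)) :=
  [set [set h + z | z in H0] | h in H].

(* The coordinates are integrated one at a time; for continuous integrands this
   is the Lebesgue integral over the unit cube. *)
Fixpoint cube_integral (R : realType) (r : nat) : ('rV[R]_r -> R) -> R :=
  match r return ('rV[R]_r -> R) -> R with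
  | 0 => fun g => g 0
  | r'.+1 => fun g =>
      \int[@lebesgue_measure R]_(t in `[0, 1])
        cube_integral (fun x : 'rV[R]_r' => g (row_mx (t%:M : 'rV[R]_1) x))
  end.

Definition ccube_integral (R : realType) (r : nat) (g : 'rV[R]_r -> R[i]) : R[i] :=
  cube_integral (fun x => complex.Re (g x)) +i*
  cube_integral (fun x => complex.Im (g x)).

Definition fourier_coef (R : realType) (r : nat) (g : torus R r -> R[i])
    (k : 'rV[int]_r) : R[i] :=
  ccube_integral (fun x => g (to_torus x) * e2pi (- dotp (intv R k) x)).

Definition cpartial (R : realType) (d : nat) (j : 'I_d) (f : 'rV[R]_d -> R[i]) :
    'rV[R]_d -> R[i] :=
  fun t => 'D_(delta_mx 0 j) (fun u => complex.Re (f u)) t +i*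
           'D_(delta_mx 0 j) (fun u => complex.Im (f u)) t.

Definition cpartials (R : realType) (d : nat) (s : seq 'I_d)
    (f : 'rV[R]_d -> R[i]) : 'rV[R]_d -> R[i] :=
  foldr (@cpartial R d) f s.

Definition csmooth (R : realType) (d : nat) (f : 'rV[R]_d -> R[i]) : Prop :=
  forall (s : seq 'I_d) (t : 'rV[R]_d),
    differentiable (fun u => complex.Re (cpartials s f u)) t /\
    differentiable (fun u => complex.Im (cpartials s f u)) t.

Definition schwartz (R : realType) (d : nat) (f : 'rV[R]_d -> R[i]) : Prop :=
  csmooth f /\
  forall (a : 'I_d -> nat) (s : seq 'I_d), exists C : R, forall t : 'rV[R]_d,
    `|\prod_(j < d) t 0 j ^+ a j| * cmod (cpartials s f t) <= C.

Definition translation (R : realType) (d : nat) (x : 'rV[R]_d)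
    (f : 'rV[R]_d -> R[i]) : 'rV[R]_d -> R[i] :=
  fun t => f (t - x).

Definition modulation (R : realType) (d : nat) (y : 'rV[R]_d)
    (f : 'rV[R]_d -> R[i]) : 'rV[R]_d -> R[i] :=
  fun t => e2pi (- dotp y t) * f t.

(* Points (t, xi) of R^d x R^d are row vectors of size d + d.  The sum over Z^d
   is the unconditional one, the limit along the finite subsets of Z^d. *)
Definition zak (R : realType) (d : nat) (f : 'rV[R]_d -> R[i])
    (z : 'rV[R]_(d + d)) : R[i] :=
  summability.sum (fun kappa : 'rV[int]_d =>
    e2pi (- dotp (rsubmx z) (intv R kappa)) * f (lsubmx z + intv R kappa)
      : R[i]^o).

(* [zak f] itself is not periodic, but its modulus is. *)
Definition zak_support (R : realType) (d : nat) (f : 'rV[R]_d -> R[i]) :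
    set (torus R (d + d)) :=
  [set z | on_torus (fun u => cmod (zak f u)) z <> 0].

Definition trigp (R : realType) (d n : nat) (x y : 'I_n -> 'rV[int]_d)
    (c : 'I_n -> R[i]) (z : 'rV[R]_(d + d)) : R[i] :=
  \sum_(k < n) c k * e2pi (- dotp (intv R (y k)) (lsubmx z))
                   * e2pi (- dotp (rsubmx z) (intv R (x k))).

Definition trigQ (R : realType) (d n : nat) (x y : 'I_n -> 'rV[int]_d)
    (c : 'I_n -> R[i]) (gamma : 'rV[R]_(d + d)) (m : nat)
    (z : torus R (d + d)) : R :=
  \prod_(j < m) cmod (on_torus (trigp x y c) (z + to_torus (gamma *+ j))).

(* Main.v *)
Require Import Defs.
From HB Require Import structures.
From mathcomp Require Import all_boot all_order all_algebra.
From mathcomp Require Import generic_quotient ring_quotient finmap.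
From mathcomp Require Import all_classical all_reals all_analysis.
From mathcomp Require Import summability complex.
From mathcomp Require Import ring lra zify.

Set Implicit Arguments.
Unset Strict Implicit.
Unset Printing Implicit Defensive.

Import Order.TTheory GRing.Theory Num.Theory.
Import numFieldNormedType.Exports.

Local Open Scope classical_set_scope.
Local Open Scope ring_scope.
Local Open Scope complex_scope.

(** Write F for the modulus of the Zak transform of f, a periodic function. The
    Zak transform turns the equation into [F (z + gamma) = |p z| F z]
    ([zak_functional_equation]), hence [F (z + m gamma) = Q_m z * F z]. So
    wherever F does not vanish,
      [log (Q_m z) = log (F (z + m gamma)) - log (F z)],
    that is, [b_lambda] is the coboundary [u (x + omega) - u x] of
    [u x = log (F (lambda + Psi x))], with [Psi] the inverse of [Phi]. Taking
    Fourier coefficients, the quotient of the statement is the modulus of the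
    k-th coefficient of u, and it remains to see that u is everywhere defined
    and smooth, and that the denominators do not vanish.

    u is defined. By the functional equation the zero set of F is stable under
    translation by [gamma]. Positive multiples of [gamma] come arbitrarily close
    to the lattice ([recurrence]), so the closed zero set is stable under
    negative multiples too, hence under their closure H
    ([zero_set_invariant]). As [F lambda <> 0], F has no zero on [lambda + H],
    which contains [lambda + H0].

    u is smooth, with rapidly decreasing coefficients. Smoothness is expressed
    and used through iterated finite differences only: a function w qualifies
    when for each N the N-th difference of step h is bounded by [C |h|^N]. This
    form passes to sums of series, to products ([sdiff_boundedM]) and to
    logarithms of functions bounded below ([sdiff_ln]), and no series or
    logarithm has to be differentiated. It transfers from the Schwartz function
    f to the square of F ([zak_sdiff]), then along [Psi], which is Lipschitz at
    the origin ([torus_hom_lipschitz]), to u ([half_log_differences]). Choosing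
    a step h with [<k, h> = 1/2], each difference multiplies the k-th
    coefficient by -2, so the coefficient is at most [C |h|^N]
    ([fourier_decay]).

    The denominators do not vanish. If q is the least positive integer with
    [q gamma] in H0, then finitely many translates of H0 cover the multiples of
    [gamma], and being closed they cover H; hence [q = m]
    ([cosets_multiples]). The same covering, applied to the kernel of a
    character instead of H0, shows that a character equal to 1 at [omega] is
    trivial ([torus_char_neq1]). The two denominators are compared by
    [|e (t) - 1| <= 4 pi ||t||]. *)

(** * Iterated differences of sequences *)

Definition sdiff (R : zmodType) (a : nat -> R) : nat -> R :=
  fun i => a i.+1 - a i.

(** The sequences in view are the values [w (x + i h)] of a function along an
    arithmetic progression, and [e] is proportional to the norm of [h]; the
    first [N.+1] terms carry all the information used. *)
Definition sdiff_bounded (R : numDomainType) (N : nat) (C e : R)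
    (a : nat -> R) : Prop :=
  forall i j, (i + j <= N)%N -> `|iter j (@sdiff R) a i| <= C * e ^+ j.

Section SequenceDifferences.
Variable R : realType.
Implicit Types (a b : nat -> R) (C e : R) (N i j : nat).

Lemma iter_sdiffD j a b i :
  iter j (@sdiff R) (fun n => a n + b n) i
  = iter j (@sdiff R) a i + iter j (@sdiff R) b i.
Proof. by elim: j i => [//|j IH] i; rewrite !iterS {1}/sdiff !IH /sdiff; ring. Qed.

Lemma iter_sdiffZ j (k : R) a i :
  iter j (@sdiff R) (fun n => k * a n) i = k * iter j (@sdiff R) a i.
Proof. by elim: j i => [//|j IH] i; rewrite !iterS {1}/sdiff !IH /sdiff; ring. Qed.

Lemma iter_sdiff_shift j a i :
  iter j (@sdiff R) (fun n => a n.+1) i = iter j (@sdiff R) a i.+1.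
Proof. by elim: j i => [//|j IH] i; rewrite !iterS {1}/sdiff !IH. Qed.

Lemma iter_sdiff_cst j (k : R) i :
  iter j.+1 (@sdiff R) (fun=> k) i = 0.
Proof.
by elim: j i => [|j IH] i; rewrite iterS /sdiff ?IH ?subrr//= subrr.
Qed.

Lemma sdiff_boundedW N C C' e a : 0 <= e -> C <= C' ->
  sdiff_bounded N C e a -> sdiff_bounded N C' e a.
Proof.
move=> e0 CC aC i j ij; apply: (le_trans (aC i j ij)).
by rewrite ler_wpM2r// exprn_ge0.
Qed.

Lemma sdiff_bounded_ge0 N C e a : sdiff_bounded N C e a -> 0 <= C.
Proof. by move/(_ 0%N 0%N isT); rewrite expr0 mulr1; apply: le_trans. Qed.

Lemma sdiff_boundedD N C C' e a b :
  sdiff_bounded N C e a -> sdiff_bounded N C' e b ->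
  sdiff_bounded N (C + C') e (fun i => a i + b i).
Proof.
move=> aC bC i j ij; rewrite iter_sdiffD mulrDl.
by apply: (le_trans (ler_normD _ _)); apply: lerD; [exact: aC|exact: bC].
Qed.

Lemma sdiff_bounded_cst N e k : 0 <= e -> sdiff_bounded N `|k| e (fun=> k).
Proof.
move=> e0 i [|j] ij; first by rewrite expr0 mulr1.
by rewrite iter_sdiff_cst normr0 mulr_ge0// exprn_ge0.
Qed.

Lemma sdiff_bounded_sdiff N C e a :
  sdiff_bounded N.+1 C e a -> sdiff_bounded N (C * e) e (sdiff a).
Proof.
by move=> aC i j ij; rewrite -iterSr -mulrA -exprS aC// addnS ltnS.
Qed.

Lemma sdiff_bounded_shift N C e a :
  sdiff_bounded N.+1 C e a -> sdiff_bounded N C e (fun i => a i.+1).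
Proof. by move=> aC i j ij; rewrite iter_sdiff_shift aC. Qed.

Lemma sdiff_boundedS N C e a :
  sdiff_bounded N.+1 C e a -> sdiff_bounded N C e a.
Proof. by move=> aC i j ij; rewrite aC// leqW. Qed.

(** The Leibniz rule Delta (ab) = (Delta a) (shift b) + a (Delta b), iterated. *)
Lemma sdiff_boundedM N C C' e a b : 0 <= e ->
  sdiff_bounded N C e a -> sdiff_bounded N C' e b ->
  sdiff_bounded N (2 ^+ N * (C * C')) e (fun i => a i * b i).
Proof.
move=> e0; elim: N C C' a b => [|N IH] C C' a b aC bC i [|j] ij.
- rewrite expr0 mul1r mulr1 normrM ler_pM//.
    by have := aC i 0%N ij; rewrite expr0 mulr1.
  by have := bC i 0%N ij; rewrite expr0 mulr1.
- by move: ij; rewrite addnS ltn0.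
- have C0 := sdiff_bounded_ge0 aC; have C'0 := sdiff_bounded_ge0 bC.
  have p2 : 1 <= 2 ^+ N.+1 :> R by rewrite exprn_ege1// ler1n.
  rewrite expr0 mulr1 normrM.
  apply: (@le_trans _ _ (C * C')); last by rewrite ler_peMl// mulr_ge0.
  rewrite ler_pM//.
    by have := aC i 0%N ij; rewrite expr0 mulr1.
  by have := bC i 0%N ij; rewrite expr0 mulr1.
rewrite iterSr.
have -> : sdiff (fun n => a n * b n)
        = (fun n => sdiff a n * b n.+1 + a n * sdiff b n).
  by apply/funext => n; rewrite /sdiff; ring.
have ij' : (i + j <= N)%N by rewrite -ltnS -addnS.
have H1 := IH _ _ _ _ (sdiff_bounded_sdiff aC) (sdiff_bounded_shift bC).
have H2 := IH _ _ _ _ (sdiff_boundedS aC) (sdiff_bounded_sdiff bC).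
apply: (le_trans (sdiff_boundedD H1 H2 ij')).
by rewrite le_eqVlt; apply/orP; left; apply/eqP; rewrite !exprS; ring.
Qed.

Lemma sdiff_bounded_horner N C (p : {poly R}) : exists C', forall e a, 0 <= e ->
  sdiff_bounded N C e a -> sdiff_bounded N C' e (fun i => p.[a i]).
Proof.
elim/poly_ind: p => [|p k [C' IH]].
  by exists `|0 : R| => e a e0 _; under eq_fun do rewrite horner0; exact: sdiff_bounded_cst.
exists (2 ^+ N * (C' * C) + `|k|) => e a e0 aC.
under eq_fun do rewrite hornerMXaddC.
by apply: sdiff_boundedD; [apply: sdiff_boundedM => //; exact: IH|exact: sdiff_bounded_cst].
Qed.

(** With no regularity at all, each difference costs a factor 2. *)
Lemma sdiff_bounded_crude N C a : 0 <= C -> (forall i, (i <= N)%N -> `|a i| <= C) ->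
  sdiff_bounded N C 2 a.
Proof.
move=> C0 aC i j; elim: j i => [|j IH] i ij.
  by rewrite expr0 mulr1 aC// (leq_trans _ ij)// leq_addr.
rewrite iterS /sdiff; apply: (le_trans (ler_normB _ _)).
have := IH i.+1; rewrite addSn -addnS => /(_ ij) H1.
have := IH i (leq_trans (leq_add (leqnn _) (leqnSn _)) ij) => H2.
apply: (le_trans (lerD H1 H2)).
by rewrite exprS; lra.
Qed.

Lemma mean_value_bound (g g' : R -> R) (x y C : R) :
  (forall z, z \in `[Num.min x y, Num.max x y] -> is_derive z (1 : R) g (g' z)) ->
  (forall z, z \in `[Num.min x y, Num.max x y] -> `|g' z| <= C) ->
  `|g y - g x| <= C * `|y - x|.
Proof.
wlog xy : x y / x < y => [H dg Cg'|].
  have [xy|yx|->] := ltgtP x y; [exact: H xy dg Cg'| |by rewrite !subrr normr0 mulr0].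
  rewrite distrC (distrC y); move: dg Cg'; rewrite minC maxC; exact: H.
rewrite (min_idPl (ltW xy)) (max_idPr (ltW xy)) => dg Cg'.
have gc : {within `[x, y], continuous g}.
  by apply: derivable_within_continuous => z zxy; apply: ex_derive; exact: dg.
have dg' z : z \in `]x, y[ -> is_derive z (1 : R) g (g' z).
  by move/subset_itv_oo_cc; exact: dg.
have [z zxy E] := MVT_segment (ltW xy) dg' gc.
by rewrite E normrM ler_wpM2r// Cg'.
Qed.

(** [p] is the Taylor polynomial; the derivative of the error is
    [(- x) ^+ n / (1 + x)], and the mean value bound gives one power of [|x|]
    more, which pays for the factor 2 coming from [1 + x >= 1/2]. *)
Lemma ln1D_taylor (n : nat) : exists p : {poly R}, forall x, `|x| <= 2^-1 ->
  `|ln (1 + x) - p.[x]| <= `|x| ^+ n.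
Proof.
pose p : {poly R} := \sum_(i < n) ((-1) ^+ i / i.+1%:R) *: 'X^(i.+1).
exists p => x x2.
pose g y : R := ln (1 + y) - p.[y].
have dp y : p^`().[y] = \sum_(i < n) (- y) ^+ i.
  rewrite /p raddf_sum horner_sum; apply: eq_bigr => i _.
  rewrite /= derivZ derivXn hornerZ hornerMn hornerXn -[in RHS]mulN1r exprMn.
  by rewrite -mulr_natr; field.
have dg y : `|y| <= 2^-1 -> is_derive y (1:R) g ((1 + y)^-1 - p^`().[y]).
  move=> y2.
  have y0 : 0 < 1 + y by have := ler_norml y 2^-1; rewrite y2 => /esym/andP[]; lra.
  have dln : is_derive (1 + y) (1:R) (@ln R) (1 + y)^-1 by exact: is_derive1_ln.
  have d1 : is_derive y (1:R) (fun z : R => 1 + z) 1.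
    have -> : (fun z : R => 1 + z) = (cst 1 + id) by [].
    by apply: (is_derive_eq (is_deriveD _ _)); rewrite add0r.
  have : is_derive y (1:R) (@ln R \o (fun z => 1 + z)) (1 + y)^-1.
    by apply: (is_derive_eq (is_derive1_comp dln d1)); rewrite mulr1.
  move=> dcomp.
  exact: is_deriveB.
have g0 : g 0 = 0.
  rewrite /g addr0 ln1 sub0r /p horner_sum big1 ?oppr0// => i _.
  by rewrite hornerZ hornerXn expr0n mulr0.
have gb y : `|y| <= 2^-1 -> `|(1 + y)^-1 - p^`().[y]| <= 2 * `|y| ^+ n.
  move=> y2.
  have y0 : 2^-1 <= 1 + y by have := ler_norml y 2^-1; rewrite y2 => /esym/andP[]; lra.
  have yn : 1 + y != 0 by rewrite gt_eqF//; lra.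
  have -> : (1 + y)^-1 - p^`().[y] = (- y) ^+ n / (1 + y).
    have := subrX1 (- y) n; rewrite -dp => H.
    have {}H : (- y) ^+ n = 1 - (1 + y) * p^`().[y] by rewrite -[LHS](subrK 1) H; ring.
    by rewrite H; field.
  rewrite normrM normfV normrX normrN mulrC ler_wpM2r ?exprn_ge0//.
  rewrite -[leRHS]invrK lef_pV2 ?posrE ?normr_gt0 ?invr_gt0//.
  by rewrite ger0_norm//; lra.
have zx_le z : z \in `[Num.min 0 x, Num.max 0 x] -> `|z| <= `|x|.
  rewrite in_itv/=; have [x0|x0] := leP 0 x => /andP[z1 z2].
    by rewrite !ger0_norm.
  by rewrite !ler0_norm ?lerN2// ltW.
have := @mean_value_bound g (fun y => (1 + y)^-1 - p^`().[y]) 0 x (2 * `|x| ^+ n).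
rewrite -/(g x) g0 !subr0; move=> H.
apply: (@le_trans _ _ (2 * `|x| ^+ n * `|x|)).
  apply: H => z /zx_le zx; first exact/dg/(le_trans zx).
  apply: (le_trans (gb _ (le_trans zx x2))).
  by rewrite ler_pM2l// lerXn2r// nnegrE.
rewrite mulrAC ler_piMl ?exprn_ge0//.
by move: x2; lra.
Qed.

Lemma sdiff_bounded_lip N C e a i : 0 <= e -> (i <= N)%N ->
  sdiff_bounded N C e a -> `|a i - a 0%N| <= i%:R * (C * e).
Proof.
move=> e0 + aC; elim: i => [|i IH] iN; first by rewrite subrr normr0 mul0r.
have -> : a i.+1 - a 0%N = iter 1 (@sdiff R) a i + (a i - a 0%N) by rewrite /= /sdiff; ring.
apply: (le_trans (ler_normD _ _)).
rewrite -natr1 mulrDl mul1r addrC lerD ?IH ?(ltnW iN)//.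
by have := aC i 1%N; rewrite addn1 expr1; apply.
Qed.

(** Near [a 0], the logarithm is a polynomial in the relative increment
    [(a i - a 0) / a 0] up to an error of order [e ^+ N], and polynomials
    preserve the bounds; when [e] is not small, [e ^+ N] is bounded below and
    the size of [ln] suffices. *)
Lemma sdiff_ln N C c : 0 < c -> exists C', forall e a, 0 <= e ->
  (forall i, c <= a i) -> sdiff_bounded N C e a ->
  `|iter N (@sdiff R) (fun i => ln (a i)) 0%N| <= C' * e ^+ N.
Proof.
move=> c0.
have [p pE] := ln1D_taylor N.
have [C1 C1E] := sdiff_bounded_horner N (2 * C / c) p.
pose B := `|ln c| + `|ln C|.
have [q qE] : exists q, q = N%:R * C / c by exists (N%:R * C / c).
(* the first three summands bound the differences of the constant, of the
   polynomial and of the Taylor error when [q * e <= 1/2]; the last one serves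
   when [q * e > 1/2] *)
pose C' := B + `|C1| + (2 * `|q|) ^+ N + B * 2 ^+ N * (2 * `|q|) ^+ N.
exists C' => e a e0 ca aC.
have eN : 0 <= e ^+ N by rewrite exprn_ge0.
have C0 := sdiff_bounded_ge0 aC.
have a0 i : 0 < a i by exact: lt_le_trans (ca i).
have aleC i : (i <= N)%N -> a i <= C.
  move=> iN; have := aC i 0%N; rewrite addn0 expr0 mulr1 => /(_ iN).
  by rewrite ger0_norm// ltW.
have q0 : 0 <= q by rewrite qE divr_ge0 ?mulr_ge0 ?ler0n// ltW.
have lnB i : (i <= N)%N -> `|ln (a i)| <= B.
  move=> iN; rewrite ler_norml; apply/andP; split.
    apply: (@le_trans _ _ (ln c)); last by rewrite ler_ln ?posrE.
    by rewrite /B lerNl; apply: (@le_trans _ _ `|ln c|); rewrite ?lerDl// -normrN ler_norm.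
  apply: (@le_trans _ _ (ln C)).
    by rewrite ler_ln ?posrE ?aleC// (lt_le_trans (a0 i))// aleC.
  by apply: (le_trans (ler_norm _)); rewrite lerDr.
have B0 : 0 <= B by rewrite addr_ge0.
rewrite /C' (ger0_norm q0); have [qe|qe] := leP (q * e) 2^-1; last first.
  have H := sdiff_bounded_crude B0 lnB (leqnn N : (0 + N <= N)%N).
  apply: (le_trans H).
  have {}qe : 1 <= (2 * q * e) ^+ N by apply: exprn_ege1; lra.
  rewrite exprMn in qe.
  have X0 : 0 <= B * 2 ^+ N by rewrite mulr_ge0// exprn_ge0.
  have Y0 : 0 <= (2 * q) ^+ N by rewrite exprn_ge0// mulr_ge0.
  apply: (@le_trans _ _ (B * 2 ^+ N * (2 * q) ^+ N * e ^+ N)).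
    by rewrite -[leRHS]mulrA ler_peMr.
  by rewrite ler_wpM2r// lerDr !addr_ge0.
pose rr i := (a i - a 0%N) / a 0%N.
have rrb i : (i <= N)%N -> `|rr i| <= q * e.
  move=> iN; rewrite /rr normrM normfV (ger0_norm (ltW (a0 0%N))).
  rewrite ler_pdivrMr//.
  apply: (le_trans (sdiff_bounded_lip e0 iN aC)).
  have qc : q * c = N%:R * C by rewrite qE divfK// gt_eqF.
  apply: (@le_trans _ _ (q * e * c)); last by rewrite ler_wpM2l ?mulr_ge0 ?ca.
  by rewrite mulrAC qc mulrA ler_wpM2r// ler_wpM2r// ler_nat.
have lnE i : ln (a i) = ln (a 0%N) + (p.[rr i] + (ln (1 + rr i) - p.[rr i])).
  have r1 : 1 + rr i = a i / a 0%N.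
    by rewrite /rr mulrBl divff ?gt_eqF// addrC subrK.
  by rewrite (addrC p.[_]) subrK r1 -lnM ?posrE ?divr_gt0// mulrC divfK// gt_eqF.
under [in X in iter _ _ X]eq_fun do rewrite lnE.
rewrite 2!iter_sdiffD.
have H1 : `|iter N (@sdiff R) (fun=> ln (a 0%N)) 0%N| <= B * e ^+ N.
  have H := sdiff_boundedW e0 (lnB 0%N isT) (@sdiff_bounded_cst N e (ln (a 0%N)) e0).
  exact: (H 0%N N (leqnn N)).
have rrD : sdiff_bounded N (2 * C / c) e rr.
  move=> i [|j] ij.
    rewrite expr0 mulr1 /= /rr normrM normfV (gtr0_norm (a0 0%N)) ler_pM ?invr_ge0 ?(ltW (a0 _))//.
      apply: (le_trans (ler_normB _ _)).
      have H k : (k <= N)%N -> `|a k| <= C by move=> kN; rewrite gtr0_norm ?aleC.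
      by have := H i; have := H 0%N isT; rewrite addn0 in ij; move=> + /(_ ij); lra.
    by rewrite lef_pV2 ?posrE.
  have -> : rr = (fun i => (a 0%N)^-1 * (a i + (- a 0%N))).
    by apply/funext => k; rewrite /rr mulrC.
  rewrite iter_sdiffZ iter_sdiffD iter_sdiff_cst addr0 normrM normfV (gtr0_norm (a0 0%N)).
  rewrite mulrC ler_pdivrMr//; apply: (le_trans (aC _ _ ij)).
  rewrite mulrAC ler_wpM2r ?exprn_ge0//.
  apply: (@le_trans _ _ (2 * C / c * c)); last by rewrite ler_wpM2l ?ca// !mulr_ge0 ?invr_ge0// ltW.
  by rewrite divfK ?gt_eqF//; lra.
have H2 : `|iter N (@sdiff R) (fun i => p.[rr i]) 0%N| <= `|C1| * e ^+ N.
  have H := sdiff_boundedW e0 (ler_norm C1) (C1E e rr e0 rrD).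
  exact: (H 0%N N (leqnn N)).
have H3 : `|iter N (@sdiff R) (fun i => ln (1 + rr i) - p.[rr i]) 0%N|
          <= (2 * q) ^+ N * e ^+ N.
  have -> : (2 * q) ^+ N * e ^+ N = (q * e) ^+ N * 2 ^+ N by rewrite -!exprMn; congr (_ ^+ N); ring.
  have qeN : 0 <= (q * e) ^+ N by rewrite exprn_ge0// mulr_ge0.
  apply: (@sdiff_bounded_crude N _ _ qeN _ 0%N N (leqnn N)) => i iN.
  apply: (le_trans (pE _ (le_trans (rrb i iN) qe))).
  by rewrite lerXn2r// ?nnegrE ?mulr_ge0// rrb.
apply: (@le_trans _ _ ((B + `|C1| + (2 * q) ^+ N) * e ^+ N)).
  have -> : (B + `|C1| + (2 * q) ^+ N) * e ^+ N
      = B * e ^+ N + (`|C1| * e ^+ N + (2 * q) ^+ N * e ^+ N) by ring.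
  apply: (le_trans (ler_normD _ _)).
  apply: (lerD H1); apply: (le_trans (ler_normD _ _)).
  exact: (lerD H2 H3).
by rewrite ler_wpM2r// lerDl !mulr_ge0// exprn_ge0// mulr_ge0.
Qed.

End SequenceDifferences.

(** * Differences of smooth functions along lines *)

Section SmoothDifferences.
Variable R : realType.

Definition fdiff (V : nmodType) (W : zmodType) (h : V) (w : V -> W) : V -> W :=
  fun x => w (x + h) - w x.

Lemma iter_fdiff_seq (V : nmodType) (W : zmodType) (h : V) (w : V -> W) x j i :
  iter j (@sdiff W) (fun n => w (x + h *+ n)) i = iter j (fdiff h) w (x + h *+ i).
Proof.
elim: j i => [//|j IH] i.
by rewrite !iterS {1}/sdiff !IH /fdiff mulrSr addrA.
Qed.

(** Iterated mean value theorem: differences commute with derivatives, so each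
    difference can be traded for one derivative. *)
Lemma fdiff_le_derive (g : nat -> R -> R) (j : nat) (C x : R) :
  (forall n s, is_derive s (1 : R) (g n) (g n.+1 s)) ->
  (forall s, x <= s <= x + j%:R -> `|g j s| <= C) ->
  `|iter j (fdiff (1 : R)) (g 0%N) x| <= C.
Proof.
elim: j g x => [|j IH] g x dg gC; first by apply: gC; rewrite addr0 lexx.
have dfd n k s : is_derive s (1 : R) (iter n (fdiff (1 : R)) (g k))
    (iter n (fdiff (1 : R)) (g k.+1) s).
  elim: n s => [|n IHn] s; first exact: dg.
  have H := IHn (s + 1).
  have Hs : is_derive s (1 : R) (fun z : R => z + 1) 1.
    have -> : (fun z : R => z + 1) = (id + cst 1) by [].
    by apply: (is_derive_eq (is_deriveD _ _)); rewrite addr0.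
  have Hc := @is_derive1_comp _ (iter n (fdiff (1 : R)) (g k)) (fun z : R => z + 1) s _ _ H Hs.
  exact: (is_derive_eq (is_deriveB Hc (IHn s)) (congr1 (fun y => y - _) (mulr1 _))).
have E : C = C * `|x + 1 - x| by rewrite (addrC x) addrK normr1 mulr1.
rewrite iterS {1}/fdiff [leRHS]E.
apply: (@mean_value_bound _ _ (iter j (fdiff (1 : R)) (g 1%N))) => z;
  rewrite (min_idPl _) ?(max_idPr _) ?lerDl// in_itv/= => /andP[xz zx].
apply: (IH (fun n => g n.+1)) => s /andP[zs sz].
by apply: gC; rewrite (le_trans xz)//= (le_trans sz)// -natr1; lra.
Qed.

Lemma sdiff_bounded_derive (g : nat -> R -> R) (N : nat) (C e : R) :
  (forall n s, is_derive s (1 : R) (g n) (g n.+1 s)) ->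
  (forall j s, (j <= N)%N -> 0 <= s <= N%:R -> `|g j s| <= C * e ^+ j) ->
  sdiff_bounded N C e (fun i => g 0%N i%:R).
Proof.
move=> dg gC i j ij.
have -> : (fun i => g 0%N i%:R) = (fun i => g 0%N (0 + 1 *+ i)).
  by apply/funext => k; rewrite add0r.
rewrite iter_fdiff_seq add0r; apply: fdiff_le_derive => // s /andP[is_ si].
apply: gC; first exact: leq_trans (leq_addl _ _) ij.
by rewrite (le_trans _ is_)//= (le_trans si)// -natrD ler_nat.
Qed.

(** Absorbs into the constant the factor by which the step is magnified; for the
    Zak series this factor grows with the lattice point. *)
Lemma sdiff_bounded_scale N (C k e : R) a : 1 <= k -> 0 <= e ->
  sdiff_bounded N C (k * e) a -> sdiff_bounded N (C * k ^+ N) e a.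
Proof.
move=> k1 e0 aC i j ij; apply: (le_trans (aC _ _ ij)).
rewrite exprMn mulrA ler_wpM2r ?exprn_ge0// ler_wpM2l ?(sdiff_bounded_ge0 aC)//.
by rewrite ler_weXn2l// (leq_trans (leq_addl _ _) ij).
Qed.

Lemma sdiff_bounded_cos N (u v : R) :
  sdiff_bounded N 1 `|v| (fun i => cos (u + v * i%:R)).
Proof.
pose g n s := v ^+ n * cos (u + v * s + n%:R * (pi / 2)).
have -> : (fun i => cos (u + v * i%:R)) = (fun i => g 0%N i%:R).
  by apply/funext => i; rewrite /g expr0 mul1r mul0r addr0.
apply: sdiff_bounded_derive => [n s|j s _ _]; last first.
  rewrite /g mul1r normrM normrX ler_piMr ?exprn_ge0//.
  by rewrite ler_norml cos_geN1 cos_le1.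
rewrite /g.
have Hl : is_derive s (1 : R) (fun s : R => u + v * s + n%:R * (pi / 2)) v.
  have -> : (fun s : R => u + v * s + n%:R * (pi / 2))
          = (cst u + v \*: id + cst (n%:R * (pi / 2))) by [].
  apply: (is_derive_eq (is_deriveD _ _)).
  by rewrite add0r addr0 /GRing.scale/= mulr1.
have Hc := @is_derive1_comp _ cos (fun s : R => u + v * s + n%:R * (pi / 2)) s _ _ (is_derive_cos _) Hl.
have := @is_deriveZ _ _ _ _ (v ^+ n) _ _ _ Hc.
move/is_derive_eq; apply.
have -> : u + v * s + n.+1%:R * (pi / 2) = u + v * s + n%:R * (pi / 2) + pi / 2.
  by rewrite -[n.+1%:R]natr1; ring.
by rewrite cosDpihalf exprSr /GRing.scale/=; ring.
Qed.

End SmoothDifferences.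

Section LineDifferences.
Variables (R : realType) (d : nat).
Implicit Types (f : 'rV[R]_d -> R) (s : seq 'I_d) (t h : 'rV[R]_d).

(** The real counterpart of [cpartials]: the mean value theorem is applied to
    real and imaginary parts separately. *)
Definition partials s f : 'rV[R]_d -> R :=
  foldr (fun j g => 'D_(delta_mx 0 j) g) f s.

(** Expanding a directional derivative over the coordinates and pushing the
    coordinate on the index keeps every term a partial derivative of [f]; this
    makes the derivative of one order into the next by definition, without
    linearity or symmetry of partial derivatives. *)
Fixpoint line_derivative h f (n : nat) s : 'rV[R]_d -> R :=
  if n is n'.+1 then
    fun t => \sum_k h 0 k * line_derivative h f n' (k :: s) t
  else partials s f.

Lemma derive_coord f t h : differentiable f t ->
  'D_h f t = \sum_k h 0 k * 'D_(delta_mx 0 k) f t.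
Proof.
move=> df; rewrite deriveE// {1}(row_sum_delta h) linear_sum/=.
by apply: eq_bigr => k _; rewrite linearZ deriveE.
Qed.

Lemma is_derive_line f t h x : differentiable f (t + x *: h) ->
  is_derive x (1 : R) (fun y : R => f (t + y *: h)) ('D_h f (t + x *: h)).
Proof.
move=> df.
have E : (fun k : R => k^-1 *: ((fun y : R => f (t + y *: h)) (k *: 1 + x) - f (t + x *: h)))
  = (fun k : R => k^-1 *: (f (k *: h + (t + x *: h)) - f (t + x *: h))).
  apply/funext => k; congr (_ *: (f _ - _)).
  by rewrite [k *: 1]mulr1 scalerDl addrCA.
split; first by rewrite /derivable /shift/= E; exact: diff_derivable.
by rewrite /derive /shift/= E.
Qed.

Lemma sdiff_bounded_line f N (B : R) t h :
  (forall s t, differentiable (partials s f) t) ->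
  (forall s (x : R), (size s <= N)%N -> 0 <= x <= N%:R ->
     `|partials s f (t + x *: h)| <= B) ->
  sdiff_bounded N B (d%:R * `|h|) (fun i => f (t + h *+ i)).
Proof.
move=> df fB.
have lD n s x : is_derive x (1 : R)
   (fun y : R => line_derivative h f n s (t + y *: h))
   (line_derivative h f n.+1 s (t + x *: h)).
  elim: n s => [|n IH] s /=.
    by rewrite -derive_coord//; exact: is_derive_line.
  rewrite (_ : (fun y : R => _) = \sum_k (h 0 k \*: (fun y => line_derivative h f n (k :: s) (t + y *: h)))); last first.
    by apply/funext => y; rewrite fct_sumE.
  apply: is_derive_sum => k; exact: is_deriveZ.
have lB n s x : (n + size s <= N)%N -> 0 <= x <= N%:R ->
    `|line_derivative h f n s (t + x *: h)| <= B * (d%:R * `|h|) ^+ n.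
  move=> + xN; elim: n s => [|n IH] s ns /=; first by rewrite expr0 mulr1 fB.
  apply: (le_trans (ler_norm_sum _ _ _)).
  have -> : B * (d%:R * `|h|) ^+ n.+1 = \sum_(k < d) (`|h| * (B * (d%:R * `|h|) ^+ n)).
    by rewrite sumr_const card_ord -mulr_natl exprS; ring.
  apply: ler_sum => k _; rewrite normrM ler_pM//.
    by rewrite /Num.Def.normr/= mx_normrE; apply: (le_bigmax _ (fun ij => `|h ij.1 ij.2|) (0, k)).
  by apply: IH; rewrite /= addnS.
have := @sdiff_bounded_derive R (fun n x => line_derivative h f n [::] (t + x *: h)) N B (d%:R * `|h|).
under eq_fun do rewrite scaler_nat.
apply => j x jN xN.
by apply: lB; rewrite ?addn0.
Qed.

End LineDifferences.

(** * Unconditional sums over the lattice *)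

#[local] Existing Instance totally_filter.

Section UnconditionalSums.
Variables (R : realType) (I : choiceType).
Implicit Types (a b w : I -> R).

Lemma totallyP (P : set {fset I}) (A : {fset I}) :
  (forall J, fsubset A J -> P J) -> \forall J \near totally, P J.
Proof. by move=> H; exists A. Qed.

Lemma partial_sumE (K : zmodType) (a : I -> K) (A : {fset I}) :
  partial_sum a A = \sum_(i <- A) a i.
Proof. by rewrite /partial_sum (big_seq_fsetE _ A predT). Qed.

Lemma partial_sum_mono w (A J : {fset I}) : (forall i, 0 <= w i) -> fsubset A J ->
  partial_sum w A <= partial_sum w J.
Proof.
move=> w0 AJ; rewrite !partial_sumE.
rewrite [leRHS](bigID (mem A))/=.
have -> : \sum_(i <- J | i \in A) w i = \sum_(i <- A) w i.
  rewrite -big_filter; apply: perm_big; apply: uniq_perm.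
  - by rewrite filter_uniq// fset_uniq.
  - exact: fset_uniq.
  by move=> i; rewrite mem_filter andb_idr// => /(fsubsetP AJ).
by rewrite lerDl sumr_ge0.
Qed.

Lemma nonneg_partial_sum_cvg w (B : R) : (forall i, 0 <= w i) ->
  (forall J : {fset I}, partial_sum w J <= B) ->
  exists s : R, partial_sum w @ totally --> s.
Proof.
move=> w0 wB; pose S := range (partial_sum w).
have supS : has_sup S.
  by split; [exists (partial_sum w fset0), fset0|exists B => _ [J _ <-]].
exists (sup S); apply/cvgrPdist_le => e e0.
have [_ [A _ <-] wA] := sup_adherent e0 supS.
apply: (@totallyP _ A) => J AJ.
have := partial_sum_mono w0 AJ.
have : partial_sum w J <= sup S by apply: ub_le_sup; [case: supS|exists J].
by move=> *; rewrite ger0_norm; lra.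
Qed.

Lemma partial_sum_cvg a w (B : R) : (forall i, `|a i| <= w i) ->
  (forall J : {fset I}, partial_sum w J <= B) ->
  exists s : R, partial_sum a @ totally --> s.
Proof.
move=> aw wB.
have H b : (forall i, 0 <= b i) -> (forall i, b i <= w i) ->
    exists s : R, partial_sum b @ totally --> s.
  move=> b0 bw; apply: (@nonneg_partial_sum_cvg b B) => // J.
  by apply: (le_trans _ (wB J)); apply: ler_sum => i _; exact: bw.
have [||s1 s1P] := H (fun i => (`|a i| + a i) / 2).
- by move=> i; have := ler_norm (- a i); rewrite normrN => ?; lra.
- by move=> i; have := ler_norm (a i); have := aw i => ? ?; lra.
have [||s2 s2P] := H (fun i => (`|a i| - a i) / 2).
- by move=> i; have := ler_norm (a i) => ?; lra.
- by move=> i; have := ler_norm (- a i); rewrite normrN; have := aw i => ? ?; lra.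
exists (s1 - s2).
have -> : partial_sum a = partial_sum (fun i => (`|a i| + a i) / 2)
   \- partial_sum (fun i => (`|a i| - a i) / 2).
  apply/funext => J; rewrite /partial_sum /= -sumrB; apply: eq_bigr => i _; lra.
exact: cvgB.
Qed.

Lemma partial_sum_norm_le a w (B s : R) : (forall i, `|a i| <= w i) ->
  (forall J : {fset I}, partial_sum w J <= B) ->
  partial_sum a @ totally --> s -> `|s| <= B.
Proof.
move=> aw wB aS; apply/ler_addgt0Pl => e e0.
have /cvgrPdist_le/(_ e e0) [A _ /(_ A (fsubset_refl A)) /= H] := aS.
rewrite -(subrK (partial_sum a A) s); apply: (le_trans (ler_normD _ _)).
apply: lerD => //; apply: (le_trans _ (wB A)).
by apply: (le_trans (ler_norm_sum _ _ _)); apply: ler_sum.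
Qed.

(** Differences pass to the limit, so a summable family of bounds for the terms
    bounds the differences of the sum: no derivative of a series is taken. *)
Lemma sdiff_bounded_sum (a : I -> nat -> R) w (B e : R) (s : nat -> R) N :
  0 <= e ->
  (forall k, sdiff_bounded N (w k) e (a k)) ->
  (forall J : {fset I}, partial_sum w J <= B) ->
  (forall i, partial_sum (a ^~ i) @ totally --> s i) ->
  sdiff_bounded N B e s.
Proof.
move=> e0 aw wB aS i j ij.
have cvgd n l : partial_sum (fun k => iter n (@sdiff R) (a k) l) @ totally -->
    iter n (@sdiff R) s l.
  elim: n l => [|n IH] l; first exact: aS.
  rewrite iterS /sdiff.
  have -> : partial_sum (fun k => iter n.+1 (@sdiff R) (a k) l)
    = partial_sum (fun k => iter n (@sdiff R) (a k) l.+1)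
      \- partial_sum (fun k => iter n (@sdiff R) (a k) l).
    by apply/funext => J; rewrite /partial_sum /= -sumrB.
  by apply: cvgB; exact: IH.
apply: (@partial_sum_norm_le (fun k => iter j (@sdiff R) (a k) i)
   (fun k => w k * e ^+ j)); last exact: cvgd.
  by move=> k; exact: aw.
by move=> J; rewrite /partial_sum -mulr_suml ler_wpM2r ?exprn_ge0// wB.
Qed.

End UnconditionalSums.

Section LatticeWeight.
Variables (R : realType) (d : nat).

(** A weight that is multiplicative in the coordinates: it dominates the linear
    growth of the phases, and sums of its powers factor. *)
Definition lattice_size (k : 'rV[int]_d) : R :=
  \prod_(j < d) (1 + `|(k 0 j)%:~R|).

Lemma lattice_size_ge1 k : 1 <= lattice_size k.
Proof.
by rewrite /lattice_size; elim/big_ind: _ => // [x y *|i _]; [exact: mulr_ege1|rewrite lerDl].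
Qed.

(** Comparison with the telescoping series [1 / m - 1 / (m + 1)]. *)
Lemma sum_inv_sqr n : \sum_(m < n) (1 + m%:R) ^- 2 <= 2 :> R.
Proof.
suff H : \sum_(m < n.+1) (1 + m%:R) ^- 2 <= 2 - (n.+1%:R)^-1 :> R.
  apply: (@le_trans _ _ (\sum_(m < n.+1) (1 + m%:R) ^- 2)).
    by rewrite big_ord_recr/= lerDl invr_ge0 exprn_ge0// addr_ge0.
  by apply: (le_trans H); rewrite gerBl invr_ge0.
elim: n => [|n IH]; first by rewrite big_ord_recr big_ord0/= add0r addr0 expr1n invr1; lra.
rewrite big_ord_recr/=; apply: (le_trans (lerD IH (lexx _))).
rewrite -[n.+2%:R]natr1 (addrC 1).
have : 1 <= n.+1%:R :> R by rewrite ler1n.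
move: (n.+1%:R) => x x1.
have E : x^-1 - (x + 1)^-1 = (x * (x + 1))^-1.
  by field; apply/andP; split; apply: lt0r_neq0; lra.
have : (x + 1) ^- 2 <= (x * (x + 1))^-1 by rewrite lef_pV2 ?posrE; nra.
by rewrite -E; lra.
Qed.

(** A finite set of lattice points lies in a cube, over which the sum is the
    [d]-th power of a one-dimensional one. *)
Lemma lattice_weight_sum (J : {fset 'rV[int]_d}) :
  partial_sum (fun k => lattice_size k ^- 2) J <= 4 ^+ d.
Proof.
pose n := (\max_(k : J) \max_(j < d) `|val k ord0 j|)%N.
have nP (k : J) j : (`|val k ord0 j|%N <= n)%N.
  apply: (leq_trans (leq_bigmax (F := fun j => `|val k ord0 j|%N) j)).
  exact: (leq_bigmax (F := fun k : J => \max_(j < d) `|val k ord0 j|)%N k).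
pose phi (k : J) : {ffun 'I_d -> 'I_(n + n).+1} :=
  [ffun j => inord (absz (val k ord0 j + n%:Z))].
pose v (m : 'I_(n + n).+1) : R := (1 + `|(m%:Z - n%:Z)%:~R|) ^- 2.
have v0 m : 0 <= v m by rewrite invr_ge0 exprn_ge0// addr_ge0.
have phiE (k : J) j : (phi k j)%:Z - n%:Z = val k ord0 j.
  by rewrite ffunE inordK; have := nP k j; lia.
have phi_inj : injective phi.
  move=> k l kl; apply/val_inj/rowP => j; rewrite -!phiE kl//.
have -> : partial_sum (fun k => lattice_size k ^- 2) J
    = \sum_(g in [set phi k | k : J]) \prod_j v (g j).
  rewrite big_imset; last by move=> k l _ _; exact: phi_inj.
  apply: eq_big => [k|k _]; first by rewrite inE.
  rewrite /lattice_size -prodrXl -prodfV; apply: eq_bigr => j _.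
  by rewrite /v phiE.
apply: (@le_trans _ _ (\sum_(g : {ffun 'I_d -> 'I_(n + n).+1}) \prod_j v (g j))).
  rewrite [leRHS](bigID (mem [set phi k | k : J]%SET))/= lerDl sumr_ge0// => g _.
  by apply: prodr_ge0.
rewrite -(bigA_distr_bigA (fun=> v))/= prodr_const card_ord lerXn2r// ?nnegrE ?sumr_ge0//.
rewrite /v -addnS big_split_ord/=.
have -> : 4 = 2 + 2 :> R by lra.
apply: lerD.
  rewrite (reindex_inj rev_ord_inj)/=.
  apply: (le_trans _ (sum_inv_sqr n)); apply: ler_sum => m _.
  rewrite lef_pV2 ?posrE ?exprn_gt0 ?ltr_pwDl//.
  rewrite lerXn2r ?nnegrE ?addr_ge0// lerD2l.
  rewrite -[leLHS]ger0_norm// -intr_norm pmulrn -intr_norm ler_int.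
  by have := ltn_ord m; lia.
apply: (le_trans _ (sum_inv_sqr n.+1)); apply: ler_sum => m _.
by rewrite PoszD addrAC subrr add0r ger0_norm.
Qed.

End LatticeWeight.

(** * Characters and decay of Schwartz functions *)

Section ComplexModulus.
Variable R : realType.
Implicit Types z w : R[i].

Lemma Re_le_cmod z : `|complex.Re z| <= cmod z.
Proof.
case: z => a b; rewrite /cmod /Normc.normc -sqrtr_sqr ler_wsqrtr//.
by rewrite lerDl sqr_ge0.
Qed.

Lemma Im_le_cmod z : `|complex.Im z| <= cmod z.
Proof.
case: z => a b; rewrite /cmod /Normc.normc -sqrtr_sqr ler_wsqrtr//.
by rewrite lerDr sqr_ge0.
Qed.

Lemma cmodM z w : cmod (z * w) = cmod z * cmod w.
Proof. exact: Normc.normcM. Qed.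

Lemma cmod_ge0 z : 0 <= cmod z.
Proof. exact: le_trans (Re_le_cmod z). Qed.

Lemma cmod_sqr z : cmod z ^+ 2 = complex.Re z ^+ 2 + complex.Im z ^+ 2.
Proof. by case: z => a b; rewrite /cmod /Normc.normc sqr_sqrtr// addr_ge0 ?sqr_ge0. Qed.

Lemma normr_cmod z : `|z| = (cmod z)%:C.
Proof. by []. Qed.

Lemma cmod_e2pi (t : R) : cmod (e2pi t) = 1.
Proof.
by apply/eqP; rewrite -sqrp_eq1 ?cmod_ge0// cmod_sqr/= cos2Dsin2.
Qed.

Lemma e2piD (s t : R) : e2pi (s + t) = e2pi s * e2pi t.
Proof.
by rewrite /e2pi mulrDr cosD sinD; simpc; congr (_ +i* _); rewrite addrC.
Qed.

Lemma e2pi0 : e2pi (0 : R) = 1.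
Proof. by rewrite /e2pi mulr0 cos0 sin0. Qed.

Lemma e2pi_nat (n : nat) : e2pi (n%:R : R) = 1.
Proof.
elim: n => [|n IH]; first by rewrite e2pi0.
rewrite -natr1 e2piD IH mul1r /e2pi mulr1 mulr_natl.
by rewrite cos2pi sin2pi.
Qed.

Lemma e2piN (t : R) : e2pi (- t) = (e2pi t)^-1.
Proof.
have H : e2pi t * e2pi (- t) = 1 by rewrite -e2piD subrr e2pi0.
have t0 : e2pi t != 0.
  by apply: contra_eq_neq H => ->; rewrite mul0r eq_sym oner_eq0.
by apply: (mulfI t0); rewrite H divff.
Qed.

Lemma e2pi_int (t : R) : t \is a Num.int -> e2pi t = 1.
Proof.
move=> /intrP[[n|n] ->]; first exact: e2pi_nat.
by rewrite NegzE mulrNz e2piN e2pi_nat invr1.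
Qed.

Lemma e2pi_addint (s t : R) : t \is a Num.int -> e2pi (s + t) = e2pi s.
Proof. by move=> tZ; rewrite e2piD (e2pi_int tZ) mulr1. Qed.

End ComplexModulus.

Section Decay.
Variables (R : realType) (d : nat).
Implicit Types (f : 'rV[R]_d -> R[i]) (s : seq 'I_d) (t : 'rV[R]_d).

Lemma partials_Re f s : partials s (fun u => complex.Re (f u)) = (fun u => complex.Re (cpartials s f u)).
Proof. by elim: s => [//|j s IH] /=; rewrite /partials/= -/(partials s _) IH. Qed.

Lemma partials_Im f s : partials s (fun u => complex.Im (f u)) = (fun u => complex.Im (cpartials s f u)).
Proof. by elim: s => [//|j s IH] /=; rewrite /partials/= -/(partials s _) IH. Qed.

(** There are finitely many multi-indices of bounded length, so bounds available
    for each one can be made uniform. *)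
Lemma uniform_bound_seq (P : seq 'I_d -> R -> Prop) N :
  (forall s C C', C <= C' -> P s C -> P s C') ->
  (forall s, exists C, P s C) -> exists C, forall s, (size s <= N)%N -> P s C.
Proof.
elim: N P => [|N IH] P Pmono PC.
  by have [C PnilC] := PC [::]; exists C => s; rewrite leqn0 => /nilP ->.
have /choice[C_ C_P] k : exists C, forall s, (size s <= N)%N -> P (k :: s) C.
  by apply: IH => [s C C'|s]; [exact: Pmono|exact: PC].
have [C0 PC0] := PC [::].
exists (`|C0| + \sum_k `|C_ k|) => -[|k s] /= sN.
  apply: Pmono PC0; apply: (le_trans (ler_norm _)).
  by rewrite lerDl sumr_ge0.
apply: Pmono (C_P k s sN); apply: (le_trans (ler_norm _)).
by rewrite (bigD1 k)//= addrCA lerDl addr_ge0// sumr_ge0.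
Qed.

Lemma schwartz_decay f (K N : nat) : schwartz f ->
  exists C : R, forall s t, (size s <= N)%N ->
    \prod_j (1 + `|t 0 j|) ^+ K * cmod (cpartials s f t) <= C.
Proof.
move=> [_ fS].
have [C CP] : exists C, forall s, (size s <= N)%N -> forall t,
    \prod_j (1 + `|t 0 j|) ^+ K * cmod (cpartials s f t) <= C.
  apply: (uniform_bound_seq (P := fun s C => forall t,
    \prod_j (1 + `|t 0 j|) ^+ K * cmod (cpartials s f t) <= C)).
    by move=> s C C' CC' H t; exact: le_trans (H t) CC'.
  move=> s.
  (* on the coordinates of size at most one the polynomial weight is bounded,
     on the others (the set [A]) it is controlled by a monomial *)
  have /choice[C_ C_P] (A : {set 'I_d}) := fS (fun j => if j \in A then K else 0%N) s.
  exists ((2 ^+ K) ^+ d * \sum_A `|C_ A|) => t.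
  pose A := [set j | 1 <= `|t 0 j|]%SET.
  apply: (@le_trans _ _ ((2 ^+ K) ^+ d * C_ A)); last first.
    rewrite ler_wpM2l ?exprn_ge0//; apply: (le_trans (ler_norm _)).
    by rewrite (bigD1 A)//= lerDl sumr_ge0.
  apply: (le_trans _ (ler_wpM2l _ (C_P A t))); last by rewrite !exprn_ge0.
  rewrite mulrA ler_wpM2r ?cmod_ge0//.
  have -> : (2 ^+ K) ^+ d = \prod_(j < d) 2 ^+ K :> R by rewrite prodr_const card_ord.
  rewrite normr_prod -big_split/=.
  apply: ler_prod => j _; rewrite exprn_ge0 ?addr_ge0//=.
  rewrite inE; case: ifPn => [t1|]; last rewrite -ltNge => t1.
    by rewrite normrX -exprMn lerXn2r// ?nnegrE ?addr_ge0 ?mulr_ge0//; lra.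
  by rewrite expr0 normr1 mulr1 lerXn2r// ?nnegrE ?addr_ge0//; lra.
by exists C => s t sN; exact: CP.
Qed.

Lemma normr_coord_le n (t : 'rV[R]_n) j : `|t 0 j| <= `|t|.
Proof.
rewrite {2}/Num.Def.normr/= mx_normrE.
exact: (le_bigmax _ (fun ij => `|t ij.1 ij.2|) (0, j)).
Qed.

(** For [t] in a bounded set, [t + k] is of the size of [k] up to a constant in
    each coordinate. *)
Lemma schwartz_lattice_decay f (K N : nat) (M : R) : schwartz f -> 0 <= M ->
  exists2 C : R, 0 <= C & forall s t k, (size s <= N)%N -> `|t| <= M ->
    cmod (cpartials s f (t + intv R k)) <= C / lattice_size R k ^+ K.
Proof.
move=> fS M0; have [C CP] := schwartz_decay K N fS.
have C0 : 0 <= C.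
  apply: (le_trans _ (CP [::] 0 isT)); by rewrite mulr_ge0 ?cmod_ge0// prodr_ge0.
exists (((1 + M) ^+ d) ^+ K * C) => [|s t k sN tM].
  by rewrite mulr_ge0// !exprn_ge0// addr_ge0.
have M1 : 0 <= ((1 + M) ^+ d) ^+ K by rewrite !exprn_ge0// addr_ge0.
have L0 : 0 < lattice_size R k ^+ K.
  by rewrite exprn_gt0// (lt_le_trans ltr01)// lattice_size_ge1.
rewrite ler_pdivlMr//.
have {}CP := CP s (t + intv R k) sN.
apply: (le_trans _ (ler_wpM2l M1 CP)).
rewrite mulrC mulrA ler_wpM2r ?cmod_ge0//.
rewrite prodrXl -exprMn lerXn2r ?nnegrE//.
- by rewrite (le_trans ler01)// lattice_size_ge1.
- by rewrite mulr_ge0 ?exprn_ge0 ?addr_ge0// prodr_ge0// => j _; rewrite addr_ge0.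
have -> : (1 + M) ^+ d = \prod_(j < d) (1 + M) by rewrite prodr_const card_ord.
rewrite -big_split/=.
apply: ler_prod => j _; rewrite addr_ge0//= !mxE.
have tj := le_trans (normr_coord_le t j) tM.
have := ler_normB (t 0 j + (k 0 j)%:~R) (t 0 j); rewrite {1}(addrC (t 0 j)) addrK => H.
have := normr_ge0 (t 0 j + (k 0 j)%:~R).
move: H tj; rewrite /intv.
move: (`|t 0 j + _|) (`|t 0 j|) (`|_%:~R|) => a b c; nra.
Qed.

End Decay.

(** * Smoothness of the Zak transform *)

Section ComplexSums.
Variables (R : realType) (I : choiceType).
Implicit Types (a b : I -> R[i]) (s : R[i]).

(** The sum of [summability.sum], as a relation: convergence becomes part of the
    statement, and algebra on sums needs no side conditions. *)
Definition has_csum a s : Prop :=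
  partial_sum (a : I -> R[i]^o) @ totally --> (s : R[i]^o).

Lemma has_csum_unique a s s' : has_csum a s -> has_csum a s' -> s = s'.
Proof. exact: (@cvg_unique _ (@norm_hausdorff _ R[i]^o)). Qed.

Lemma has_csum_sum a s : has_csum a s -> summability.sum (a : I -> R[i]^o) = s.
Proof. exact: (@cvg_lim _ (@norm_hausdorff _ R[i]^o)). Qed.

Lemma Re_sum (J : Type) (r : seq J) P (F : J -> R[i]) :
  complex.Re (\sum_(i <- r | P i) F i) = \sum_(i <- r | P i) complex.Re (F i).
Proof. by apply: (big_morph _ _ _) => // -[? ?] [? ?]. Qed.

Lemma Im_sum (J : Type) (r : seq J) P (F : J -> R[i]) :
  complex.Im (\sum_(i <- r | P i) F i) = \sum_(i <- r | P i) complex.Im (F i).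
Proof. by apply: (big_morph _ _ _) => // -[? ?] [? ?]. Qed.

Lemma cmod_le_ReIm s : cmod s <= `|complex.Re s| + `|complex.Im s|.
Proof.
rewrite -[leRHS]ger0_norm ?addr_ge0// -sqrtr_sqr -[cmod s]ger0_norm ?cmod_ge0//.
rewrite -sqrtr_sqr ler_wsqrtr// cmod_sqr sqrrD !real_normK ?num_real//.
by rewrite addrAC lerDl mulrn_wge0// mulr_ge0.
Qed.

(** Reduction to real series, where absolute convergence is available. *)
Lemma has_csumP a s :
  has_csum a s <->
  partial_sum (fun i => complex.Re (a i)) @ totally --> complex.Re s /\
  partial_sum (fun i => complex.Im (a i)) @ totally --> complex.Im s.
Proof.
split=> [/cvgrPdist_le H|[/cvgrPdist_le Hr /cvgrPdist_le Hi]].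
- have {}H e : 0 < e -> \forall J \near totally, cmod (s - partial_sum a J) <= e.
    move=> e0; have := H e%:C; rewrite ltcR => /(_ e0).
    by apply: filterS => J; rewrite normr_cmod lecR.
  split; apply/cvgrPdist_le => e /H; apply: filterS => J; apply: le_trans.
  - apply: le_trans (Re_le_cmod _); rewrite /partial_sum -Re_sum.
    by case: s (\sum_(_ <- _) _) {H} => [? ?] [? ?].
  - apply: le_trans (Im_le_cmod _); rewrite /partial_sum -Im_sum.
    by case: s (\sum_(_ <- _) _) {H} => [? ?] [? ?].
apply/cvgrPdist_le => -[e e']; rewrite ltcE/= => /andP[/eqP -> e0].
have e2 : 0 < e / 2 by rewrite divr_gt0.
apply: filterS2 (Hr _ e2) (Hi _ e2) => J rJ iJ.
rewrite -[_ +i* _]/(e%:C) normr_cmod lecR; apply: (le_trans (cmod_le_ReIm _)).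
rewrite [e]splitr; apply: lerD.
- apply: le_trans rJ; rewrite /partial_sum -Re_sum.
  by case: s (\sum_(_ <- _) _) {Hr Hi iJ} => [? ?] [? ?].
apply: le_trans iJ; rewrite /partial_sum -Im_sum.
by case: s (\sum_(_ <- _) _) {Hr Hi rJ} => [? ?] [? ?].
Qed.

Lemma has_csumZ (c : R[i]) a s : has_csum a s -> has_csum (fun i => c * a i) (c * s).
Proof.
move=> H; rewrite /has_csum.
have -> : partial_sum ((fun i => c * a i) : I -> R[i]^o) = (fun J => c *: (partial_sum (a : I -> R[i]^o) J)).
  by apply/funext => J; rewrite /partial_sum scaler_sumr.
exact: cvgZr.
Qed.

Lemma has_csum_bigsum (K : Type) (r : seq K) (a : K -> I -> R[i]) (s : K -> R[i]) :
  (forall k, has_csum (a k) (s k)) ->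
  has_csum (fun i => \sum_(k <- r) a k i) (\sum_(k <- r) s k).
Proof.
move=> H; elim: r => [|k r IH]; rewrite /has_csum.
  rewrite big_nil; have -> : partial_sum ((fun i => \sum_(k <- [::]) a k i) : I -> R[i]^o) = cst 0.
    by apply/funext => J; rewrite /partial_sum big1// => i _; rewrite big_nil.
  exact: cvg_cst.
rewrite big_cons.
have -> : partial_sum ((fun i => \sum_(k <- k :: r) a k i) : I -> R[i]^o)
   = partial_sum (a k : I -> R[i]^o) \+ partial_sum ((fun i => \sum_(k <- r) a k i) : I -> R[i]^o).
  apply/funext => J; rewrite /partial_sum/= -big_split/=.
  by apply: eq_bigr => i _; rewrite big_cons.
by apply: cvgD; [exact: H|exact: IH].
Qed.

Lemma has_csum_reindex (sigma tau : I -> I) a s : cancel sigma tau -> cancel tau sigma ->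
  has_csum a s -> has_csum (a \o sigma) s.
Proof.
move=> st ts H P /H [A _ AP].
exists [fset tau x | x in A]%fset => //= J AJ.
have /= := AP [fset sigma x | x in J]%fset.
have -> : partial_sum (a : I -> R[i]^o) [fset sigma x | x in J]%fset
       = partial_sum ((a \o sigma) : I -> R[i]^o) J.
  rewrite !partial_sumE big_imfset//= => x y _ _; exact: (can_inj st).
apply; apply/fsubsetP => x xA; apply/imfsetP; exists (tau x); rewrite ?ts//=.
by apply: (fsubsetP AJ); apply/imfsetP; exists x.
Qed.

End ComplexSums.
Arguments has_csumZ {R I} c {a s}.
Arguments has_csum_bigsum {R I K} r {a s}.
Arguments has_csum_reindex {R I sigma tau a s}.
Arguments has_csum_unique {R I a s s'}.

Section ZakTransform.
Variables (R : realType) (d : nat).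
Implicit Types (f : 'rV[R]_d -> R[i]) (z a : 'rV[R]_(d + d)) (k : 'rV[int]_d).

Definition zak_term f z k : R[i] :=
  e2pi (- dotp (rsubmx z) (intv R k)) * f (lsubmx z + intv R k).

Lemma dotpDl n (u v w : 'rV[R]_n) : dotp (u + v) w = dotp u w + dotp v w.
Proof. by rewrite /dotp -big_split; apply: eq_bigr => i _; rewrite mxE mulrDl. Qed.

Lemma dotpC n (u v : 'rV[R]_n) : dotp u v = dotp v u.
Proof. by apply: eq_bigr => i _; rewrite mulrC. Qed.

Lemma dotpDr n (u v w : 'rV[R]_n) : dotp w (u + v) = dotp w u + dotp w v.
Proof. by rewrite dotpC dotpDl !(dotpC w). Qed.

Lemma dotpNl n (u w : 'rV[R]_n) : dotp (- u) w = - dotp u w.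
Proof. by rewrite /dotp -sumrN; apply: eq_bigr => i _; rewrite mxE mulNr. Qed.

Lemma dotpNr n (u w : 'rV[R]_n) : dotp w (- u) = - dotp w u.
Proof. by rewrite dotpC dotpNl dotpC. Qed.

Lemma dotpMnl n (u w : 'rV[R]_n) i : dotp (u *+ i) w = dotp u w * i%:R.
Proof.
elim: i => [|i IH]; last by rewrite mulrS dotpDl IH -natr1; ring.
by rewrite mulr0n mulr0 /dotp big1// => j _; rewrite mxE mul0r.
Qed.

Lemma normr_dotp_le (u : 'rV[R]_d) k :
  `|dotp u (intv R k)| <= d%:R * lattice_size R k * `|u|.
Proof.
apply: (le_trans (ler_norm_sum _ _ _)).
have -> : d%:R * lattice_size R k * `|u| = \sum_(j < d) (`|u| * lattice_size R k).
  by rewrite sumr_const card_ord -mulr_natl; ring.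
apply: ler_sum => j _; rewrite normrM ler_pM ?normr_coord_le//.
rewrite mxE /lattice_size (bigD1 j)//=.
have : 1 <= \prod_(i < d | i != j) (1 + `|(k 0 i)%:~R|) :> R.
  by elim/big_ind: _ => // [x y *|i _]; [exact: mulr_ege1|rewrite lerDl].
have := normr_ge0 ((k 0 j)%:~R : R); nra.
Qed.

Lemma norm_lsubmx_le z : `|lsubmx z| <= `|z|.
Proof.
rewrite {1}/Num.Def.normr/= mx_normrE; apply: bigmax_le => // -[i j] _ /=.
by rewrite mxE ord1 normr_coord_le.
Qed.

Lemma norm_rsubmx_le z : `|rsubmx z| <= `|z|.
Proof.
rewrite {1}/Num.Def.normr/= mx_normrE; apply: bigmax_le => // -[i j] _ /=.
by rewrite mxE ord1 normr_coord_le.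
Qed.

Lemma sdiff_bounded_le_step N (C e e' : R) w : 0 <= e -> e <= e' ->
  sdiff_bounded N C e w -> sdiff_bounded N C e' w.
Proof.
move=> e0 ee wC i j ij; apply: (le_trans (wC _ _ ij)).
by rewrite ler_wpM2l ?(sdiff_bounded_ge0 wC)// lerXn2r// nnegrE// (le_trans e0).
Qed.

(** The phase contributes at most [lattice_size k ^+ N] to the [N]-th
    differences; the decay of [f] is taken two orders stronger, which leaves a
    summable weight. *)
Lemma zak_term_sdiff f (N : nat) (M : R) : schwartz f -> 0 <= M ->
  exists2 C : R, 0 <= C & forall z a k, `|z| <= M -> `|a| <= 1 ->
    sdiff_bounded N (C / lattice_size R k ^+ 2) `|a|
      (fun i => complex.Re (zak_term f (z + a *+ i) k)) /\
    sdiff_bounded N (C / lattice_size R k ^+ 2) `|a|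
      (fun i => complex.Im (zak_term f (z + a *+ i) k)).
Proof.
move=> fS M0.
have MN0 : 0 <= M + N%:R by rewrite addr_ge0.
have [B B0 BP] := schwartz_lattice_decay (2 + N) N fS MN0.
pose c : R := 1 + 2 * pi * d%:R.
have pi0 : 0 <= pi :> R by exact: pi_ge0.
have c1 : 1 <= c by rewrite lerDl !mulr_ge0.
pose C1 : R := B * (1 + d%:R) ^+ N.
exists (2 * (2 ^+ N * (c ^+ N * C1))).
  have c0 : 0 <= c by exact: le_trans c1.
  have C10 : 0 <= C1 by rewrite mulr_ge0// exprn_ge0// addr_ge0.
  by rewrite mulr_ge0// mulr_ge0 ?exprn_ge0// mulr_ge0// exprn_ge0.
move=> z a k zM a1.
set L := lattice_size R k.
have L1 : 1 <= L by exact: lattice_size_ge1.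
have L0 : 0 < L by rewrite (lt_le_trans ltr01).
have an0 : 0 <= `|a| by [].
have trig (u0 : R) : sdiff_bounded N ((c * L) ^+ N) `|a|
    (fun i => cos (2 * pi * (- dotp (rsubmx (z + a *+ i)) (intv R k)) + u0)).
  rewrite -[_ ^+ N]mul1r; apply: sdiff_bounded_scale => //; first exact: mulr_ege1.
  pose v := - (2 * pi * dotp (rsubmx a) (intv R k)).
  have -> : (fun i => cos (2 * pi * (- dotp (rsubmx (z + a *+ i)) (intv R k)) + u0))
     = (fun i => cos ((2 * pi * (- dotp (rsubmx z) (intv R k)) + u0) + v * i%:R)).
    apply/funext => i; rewrite raddfD raddfMn dotpDl dotpMnl /v; congr cos; ring.
  apply: (@sdiff_bounded_le_step _ _ `|v|) => //; last exact: sdiff_bounded_cos.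
  rewrite /v normrN normrM ger0_norm ?mulr_ge0//.
  apply: (le_trans (ler_wpM2l _ (normr_dotp_le _ _))); first by rewrite mulr_ge0.
  rewrite mulrA ler_pM ?norm_rsubmx_le// ?mulr_ge0//; first exact: ltW.
  rewrite /c -/L; nra.
have wave (g : 'rV[R]_d -> R) : (forall s t, differentiable (partials s g) t) ->
    (forall s t, `|partials s g t| <= cmod (cpartials s f t)) ->
    sdiff_bounded N (C1 / L ^+ (2 + N)) `|a| (fun i => g (lsubmx (z + a *+ i) + intv R k)).
  move=> dg gf.
  have -> : (fun i => g (lsubmx (z + a *+ i) + intv R k))
     = (fun i => g ((lsubmx z + intv R k) + lsubmx a *+ i)).
    by apply/funext => i; rewrite raddfD raddfMn addrAC.
  have -> : C1 / L ^+ (2 + N) = B / L ^+ (2 + N) * (1 + d%:R) ^+ N by rewrite /C1; ring.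
  apply: sdiff_bounded_scale => //; first by rewrite lerDl.
  apply: (@sdiff_bounded_le_step _ _ (d%:R * `|lsubmx a|)); first by rewrite mulr_ge0.
    by rewrite ler_pM ?norm_lsubmx_le// lerDr.
  apply: sdiff_bounded_line => // s x sN /andP[x0 xN].
  apply: (le_trans (gf _ _)); rewrite addrAC; apply: BP => //.
  apply: (le_trans (ler_normD _ _)); rewrite normrZ (ger0_norm x0).
  apply: lerD; first exact: le_trans (norm_lsubmx_le _) _.
  rewrite -[leRHS]mulr1 ler_pM//; exact: le_trans (norm_lsubmx_le _) _.
have dRe s t : differentiable (partials s (fun u => complex.Re (f u))) t.
  by rewrite partials_Re; have [+ _] := fS => /(_ s t)[].
have dIm s t : differentiable (partials s (fun u => complex.Im (f u))) t.
  by rewrite partials_Im; have [+ _] := fS => /(_ s t)[].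
have wRe : sdiff_bounded N (C1 / L ^+ (2 + N)) `|a|
    (fun i => complex.Re (f (lsubmx (z + a *+ i) + intv R k))).
  by apply: (wave (fun u => complex.Re (f u))) => // s t; rewrite partials_Re Re_le_cmod.
have wIm : sdiff_bounded N (C1 / L ^+ (2 + N)) `|a|
    (fun i => complex.Im (f (lsubmx (z + a *+ i) + intv R k))).
  by apply: (wave (fun u => complex.Im (f u))) => // s t; rewrite partials_Im Im_le_cmod.
have E : 2 * (2 ^+ N * (c ^+ N * C1)) / L ^+ 2
   = 2 ^+ N * ((c * L) ^+ N * (C1 / L ^+ (2 + N))) + 2 ^+ N * ((c * L) ^+ N * (C1 / L ^+ (2 + N))).
  by rewrite exprMn exprD; field; rewrite expf_eq0 gt_eqF ?andbF.
rewrite E; split.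
- have -> : (fun i => complex.Re (zak_term f (z + a *+ i) k))
    = (fun i => cos (2 * pi * (- dotp (rsubmx (z + a *+ i)) (intv R k)) + 0)
                 * complex.Re (f (lsubmx (z + a *+ i) + intv R k))
              + cos (2 * pi * (- dotp (rsubmx (z + a *+ i)) (intv R k)) + pi / 2)
                 * complex.Im (f (lsubmx (z + a *+ i) + intv R k))).
    apply/funext => i; rewrite addr0 cosDpihalf mulNr /zak_term /e2pi.
    by case: (f _).
  by apply: sdiff_boundedD; apply: sdiff_boundedM => //; exact: trig.
have -> : (fun i => complex.Im (zak_term f (z + a *+ i) k))
    = (fun i => cos (2 * pi * (- dotp (rsubmx (z + a *+ i)) (intv R k)) + 0)
                 * complex.Im (f (lsubmx (z + a *+ i) + intv R k))
              + cos (2 * pi * (- dotp (rsubmx (z + a *+ i)) (intv R k)) - pi / 2)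
                 * complex.Re (f (lsubmx (z + a *+ i) + intv R k))).
    apply/funext => i; rewrite addr0 cosBpihalf /zak_term /e2pi.
    by case: (f _).
by apply: sdiff_boundedD; apply: sdiff_boundedM => //; exact: trig.
Qed.

Lemma zak_has_csum f z : schwartz f -> has_csum (zak_term f z) (zak f z).
Proof.
move=> fS; have [C C0 CP] := zak_term_sdiff 0 fS (normr_ge0 z).
have CJ (J : {fset 'rV[int]_d}) : partial_sum (fun k => C / lattice_size R k ^+ 2) J <= C * 4 ^+ d.
  by rewrite /partial_sum -mulr_sumr ler_wpM2l// lattice_weight_sum.
have H k := CP z 0 k (lexx _); rewrite normr0 in H.
have [|sr srP] := @partial_sum_cvg _ _ (fun k => complex.Re (zak_term f z k)) _ _ _ CJ.
  by move=> k; have [+ _] := H k ler01 => /(_ 0%N 0%N isT); rewrite /= mulr0n addr0 expr0 mulr1.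
have [|si siP] := @partial_sum_cvg _ _ (fun k => complex.Im (zak_term f z k)) _ _ _ CJ.
  by move=> k; have [_] := H k ler01 => /(_ 0%N 0%N isT); rewrite /= mulr0n addr0 expr0 mulr1.
have S : has_csum (zak_term f z) (sr +i* si) by apply/has_csumP.
by rewrite /zak (has_csum_sum S).
Qed.

(** The square of the modulus is a polynomial in real and imaginary part, whereas
    the modulus itself need not be smooth at zeros. The bounds hold on bounded
    sets only, because the transform is merely quasi-periodic. *)
Lemma zak_sdiff f (N : nat) (M : R) : schwartz f -> 0 <= M ->
  exists C : R, forall z a, `|z| <= M -> `|a| <= 1 ->
    sdiff_bounded N C `|a| (fun i => cmod (zak f (z + a *+ i)) ^+ 2).
Proof.
move=> fS M0; have [C C0 CP] := zak_term_sdiff N fS M0.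
have CJ (J : {fset 'rV[int]_d}) : partial_sum (fun k => C / lattice_size R k ^+ 2) J <= C * 4 ^+ d.
  by rewrite /partial_sum -mulr_sumr ler_wpM2l// lattice_weight_sum.
pose D := C * 4 ^+ d.
exists (2 ^+ N * (D * D) + 2 ^+ N * (D * D)) => z a zM a1.
have S i := (iffLR (has_csumP _ _)) (zak_has_csum fS : has_csum (zak_term f (z + a *+ i)) _).
have dRe : sdiff_bounded N D `|a| (fun i => complex.Re (zak f (z + a *+ i))).
  apply: (@sdiff_bounded_sum _ _ (fun k i => complex.Re (zak_term f (z + a *+ i) k)) _ _ _ _ _ _ _ CJ) => //.
    by move=> k; have [] := CP z a k zM a1.
  by move=> i; have [] := S i.
have dIm : sdiff_bounded N D `|a| (fun i => complex.Im (zak f (z + a *+ i))).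
  apply: (@sdiff_bounded_sum _ _ (fun k i => complex.Im (zak_term f (z + a *+ i) k)) _ _ _ _ _ _ _ CJ) => //.
    by move=> k; have [] := CP z a k zM a1.
  by move=> i; have [] := S i.
under eq_fun do rewrite cmod_sqr !expr2.
by apply: sdiff_boundedD; apply: sdiff_boundedM.
Qed.

End ZakTransform.

(** * Functional equations of the Zak transform; the torus *)

Section ZakEquations.
Variables (R : realType) (d : nat).
Implicit Types (f : 'rV[R]_d -> R[i]) (z : 'rV[R]_(d + d)).

Lemma intvD n (u v : 'rV[int]_n) : intv R (u + v) = intv R u + intv R v.
Proof. by rewrite /intv map_mxD. Qed.

Lemma intvN n (u : 'rV[int]_n) : intv R (- u) = - intv R u.
Proof. by rewrite /intv map_mxN. Qed.

Lemma dotp_intv_int n (u v : 'rV[int]_n) : dotp (intv R u) (intv R v) \is a Num.int.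
Proof. by apply: rpred_sum => i _; rewrite !mxE rpredM// intr_int. Qed.

Lemma lsubmx_intv (n : 'rV[int]_(d + d)) : lsubmx (intv R n) = intv R (lsubmx n).
Proof. by apply/rowP => i; rewrite !mxE. Qed.

Lemma rsubmx_intv (n : 'rV[int]_(d + d)) : rsubmx (intv R n) = intv R (rsubmx n).
Proof. by apply/rowP => i; rewrite !mxE. Qed.

(** A lattice translation in the first variable reindexes the series and comes
    out as a character of modulus one; in the second variable it changes
    nothing. *)
Lemma cmod_zak_periodic f z (n : 'rV[int]_(d + d)) : schwartz f ->
  cmod (zak f (z + intv R n)) = cmod (zak f z).
Proof.
move=> fS; pose l := lsubmx n.
have H := zak_has_csum fS : has_csum (zak_term f z) _.
have {}H := has_csumZ (e2pi (dotp (rsubmx z) (intv R l)))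
  (has_csum_reindex (addrK l) (subrK l) H).
suff E : zak_term f (z + intv R n) =
    (fun k => e2pi (dotp (rsubmx z) (intv R l)) * (zak_term f z \o +%R^~ l) k).
  have := zak_has_csum fS : has_csum (zak_term f (z + intv R n)) _.
  by rewrite E => /has_csum_unique /(_ H) ->; rewrite cmodM cmod_e2pi mul1r.
apply/funext => k /=; rewrite /zak_term.
rewrite !raddfD/= lsubmx_intv rsubmx_intv -/l mulrA -e2piD; congr (_ * f _).
  rewrite intvD dotpDl dotpDr !opprD.
  rewrite [LHS]e2pi_addint ?rpredN ?dotp_intv_int//; congr e2pi; ring.
by rewrite intvD -addrA (addrC (intv R l)).
Qed.

(** The Zak transform turns integer time-frequency shifts into multiplication
    by characters, and the shift by [(alpha, beta)] into a translation. *)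
Lemma zak_functional_equation n (x y : 'I_n -> 'rV[int]_d) (alpha beta : 'rV[R]_d)
    f (c : 'I_n -> R[i]) z :
  schwartz f ->
  (fun t => \sum_(k < n) c k *
       modulation (intv R (y k)) (translation (intv R (x k)) f) t)
  = modulation beta (translation alpha f) ->
  cmod (zak f (z + row_mx (- alpha) beta)) = cmod (trigp x y c z) * cmod (zak f z).
Proof.
move=> fS feq; pose w := z + row_mx (- alpha) beta.
pose t := lsubmx z.
have Hz := zak_has_csum fS : has_csum (zak_term f z) _.
have Hw := zak_has_csum fS : has_csum (zak_term f w) _.
have {}Hw := has_csumZ (e2pi (- dotp beta t)) Hw.
have Hk k := has_csumZ (c k * e2pi (- dotp (intv R (y k)) (lsubmx z))
      * e2pi (- dotp (rsubmx z) (intv R (x k))))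
   (has_csum_reindex (subrK (x k)) (addrK (x k)) Hz).
have {}Hk := has_csum_bigsum (index_enum 'I_n) Hk.
have E : e2pi (- dotp beta t) * zak f w = trigp x y c z * zak f z.
  rewrite /trigp mulr_suml.
  apply: (has_csum_unique Hw).
  suff -> : (fun i => e2pi (- dotp beta t) * zak_term f w i) =
    (fun i => \sum_k c k * e2pi (- dotp (intv R (y k)) (lsubmx z))
      * e2pi (- dotp (rsubmx z) (intv R (x k))) * (zak_term f z \o +%R^~ (- x k)) i) by [].
  apply/funext => i.
  have := congr1 (fun g => e2pi (- dotp (rsubmx z) (intv R i)) * g (t + intv R i)) feq.
  rewrite /= mulr_sumr => H.
  transitivity (e2pi (- dotp (rsubmx z) (intv R i)) * modulation beta (translation alpha f) (t + intv R i)).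
    rewrite /modulation /translation /zak_term /w !raddfD/= row_mxKl row_mxKr !mulrA -!e2piD -/t.
    by congr (e2pi _ * f _); [rewrite dotpDl dotpDr; ring|rewrite addrAC].
  rewrite -H; apply: eq_bigr => k _.
  rewrite /modulation /translation /zak_term -/t/= !mulrA; congr (_ * f _); last first.
    by rewrite intvD intvN addrA.
  rewrite (mulrC _ (c k)) -!mulrA; congr (_ * _); rewrite -!e2piD intvD intvN.
  rewrite !dotpDr dotpNr.
  rewrite -[RHS](@e2pi_addint _ _ (- dotp (intv R (y k)) (intv R i))).
    by congr e2pi; ring.
  by rewrite rpredN dotp_intv_int.
by have := congr1 (@cmod R) E; rewrite !cmodM cmod_e2pi mul1r.
Qed.

End ZakEquations.

(** * The torus as a quotient group *)

Section Torus.
Variables (R : realType) (n : nat).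
Local Notation T := (torus R n).
Implicit Types (u v : 'rV[R]_n) (z w : T).

Lemma to_torus_repr z : to_torus (repr z) = z.
Proof. exact: reprK. Qed.

Lemma intvecP u : reflect (exists k, u = intv R k) (u \in @intvec R n).
Proof.
apply: (iffP forallP) => [uZ|[k ->] i]; last by rewrite mxE intr_int.
exists (\row_i Num.floor (u 0 i)); apply/rowP => i; rewrite !mxE.
by have /intrP[m ->] := uZ i; rewrite intrKfloor.
Qed.

Lemma to_torusP u v : to_torus u = to_torus v <-> exists k, u = v + intv R k.
Proof.
have E : (to_torus u = to_torus v) <-> (u - v \in @intvec R n).
  have H := @Quotient.idealrBE _ (@intvec R n) u v.
  split=> [uv|uv]; last first.
    have K : (u == v %[mod Quotient.quot (@intvec R n)])%qT by rewrite -H.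
    by move/eqP: K.
  have K : (u == v %[mod Quotient.quot (@intvec R n)])%qT by apply/eqP; exact: uv.
  by rewrite -H in K.
rewrite E; split=> [/intvecP[k uv]|[k ->]].
  by exists k; rewrite -uv addrC subrK.
by apply/intvecP; exists k; rewrite addrC addKr.
Qed.

Lemma to_torusD u v : to_torus (u + v) = to_torus u + to_torus v.
Proof. exact: (@Quotient.pi_add _ (@intvec R n)). Qed.

Lemma to_torusN u : to_torus (- u) = - to_torus u.
Proof. exact: (@Quotient.pi_opp _ (@intvec R n)). Qed.

End Torus.

(** * Topology of the torus *)

Section TorusTopology.
Variables (R : realType) (n : nat).
Local Notation T := (torus R n).
Implicit Types (u v : 'rV[R]_n) (z w : T) (k : 'rV[int]_n).

Definition periodic_rV (X : Type) (g : 'rV[R]_n -> X) : Prop :=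
  forall u k, g (u + intv R k) = g u.

Lemma to_torus0 : to_torus 0 = 0 :> T.
Proof. by apply: (addrI (to_torus 0)); rewrite -to_torusD !addr0. Qed.

Lemma to_torusMn u i : to_torus (u *+ i) = to_torus u *+ i :> T.
Proof. by elim: i => [|i IH]; rewrite ?mulr0n ?to_torus0// !mulrS to_torusD IH. Qed.

Lemma to_torusMz u (i : int) : to_torus (u *~ i) = to_torus u *~ i :> T.
Proof.
by case: i => i; rewrite ?NegzE ?mulrNz ?to_torusN -!pmulrn to_torusMn.
Qed.

Lemma to_torus_intv k : to_torus (intv R k) = 0 :> T.
Proof. by rewrite -to_torus0; apply/to_torusP; exists k; rewrite add0r. Qed.

Lemma intvMn k i : intv R (k *+ i) = intv R k *+ i.
Proof.
elim: i => [|i IH]; last by rewrite !mulrS intvD IH.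
by apply/rowP => j; rewrite !mxE.
Qed.

Lemma on_torusE (X : Type) (g : 'rV[R]_n -> X) u : periodic_rV g ->
  on_torus g (to_torus u) = g u.
Proof.
move=> gP; rewrite /on_torus.
have /to_torusP[k ->] := to_torus_repr (to_torus u); exact: gP.
Qed.

Lemma to_torus_continuous : continuous (@to_torus R n).
Proof. exact: (@pi_continuous _ (Quotient.quot (@intvec R n))). Qed.

Lemma torus_continuous (X : topologicalType) (g : T -> X) :
  continuous (g \o @to_torus R n) -> continuous g.
Proof. by move=> H; apply/(@quotient_continuous _ (Quotient.quot (@intvec R n))). Qed.

Lemma on_torus_continuous (X : topologicalType) (g : 'rV[R]_n -> X) :
  periodic_rV g -> continuous g -> continuous (on_torus g).
Proof.
move=> gP gc; apply: torus_continuous.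
by rewrite (_ : _ \o _ = g)//; apply/funext => u /=; rewrite on_torusE.
Qed.

Lemma torus_translation_continuous w : continuous (fun z => z + w).
Proof.
apply: torus_continuous; rewrite -(to_torus_repr w).
rewrite (_ : _ \o _ = @to_torus R n \o (fun u => u + repr w)); last first.
  by apply/funext => u /=; rewrite to_torusD.
move=> u; apply: continuous_comp; last exact: to_torus_continuous.
exact: (cvgD cvg_id (cvg_cst _)).
Qed.

Lemma torus_opp_continuous : continuous (fun z => - z).
Proof.
apply: torus_continuous.
rewrite (_ : _ \o _ = @to_torus R n \o (fun u => - u)); last first.
  by apply/funext => u /=; rewrite to_torusN.
move=> u; apply: continuous_comp; last exact: to_torus_continuous.
exact: (cvgN cvg_id).
Qed.

(** The preimage in the vector space is a union of balls around lattice points,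
    hence open. *)
Lemma torus_small_nbhs (e : R) : 0 < e ->
  nbhs (0 : T) [set z | exists2 u, `|u| < e & to_torus u = z].
Proof.
move=> e0; rewrite nbhsE; exists [set z | exists2 u, `|u| < e & to_torus u = z] => //.
split; last by exists 0; rewrite ?normr0// to_torus0.
rewrite /open/= /quotient_open.
rewrite (_ : _ @^-1` _ = \bigcup_(k in [set: 'rV[int]_n]) [set v | `|v - intv R k| < e]).
  apply: bigcup_open => k _.
  have -> : [set v : 'rV[R]_n | `|v - intv R k| < e] = ball (intv R k) e.
    by apply/seteqP; split=> v; rewrite /= -ball_normE/= distrC.
  exact: ball_open.
apply/seteqP; split=> [v [u ue /to_torusP[k uv]]|v [k _ vk]].
  by exists (- k) => //=; rewrite intvN opprK -uv.
exists (v - intv R k) => //; apply/to_torusP; exists (- k).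
by rewrite intvN.
Qed.

Lemma normr_rV_le (u : 'rV[R]_n) (e : R) : 0 <= e ->
  (forall i, `|u 0 i| <= e) -> `|u| <= e.
Proof.
move=> e0 ue; rewrite /Num.Def.normr/= mx_normrE; apply: bigmax_le => // -[i j] _ /=.
by rewrite ord1.
Qed.

Lemma unit_cube_compact : compact [set u : 'rV[R]_n | forall i, `[0, 1]%classic (u 0 i)].
Proof. by apply: (@rV_compact R n (fun=> `[0, 1]%classic)) => i; exact: segment_compact. Qed.

Lemma frac_rV u : exists v k, u = v + intv R k /\ (forall i, 0 <= v 0 i < 1).
Proof.
exists (\row_i (u 0 i - (Num.floor (u 0 i))%:~R)), (\row_i Num.floor (u 0 i)).
split=> [|i]; first by apply/rowP => i; rewrite !mxE subrK.
by rewrite mxE subr_ge0 floor_le_tmp ltrBlDr addrC -intrD1 floorD1_gt.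
Qed.

Lemma frac_rV_norm u : exists v k, u = v + intv R k /\ `|v| <= 1.
Proof.
have [v [k [-> vP]]] := frac_rV u; exists v, k; split => //.
by apply: normr_rV_le => // i; have /andP[v0 v1] := vP i; rewrite ger0_norm// ltW.
Qed.

(** By compactness of the cube two fractional parts of multiples of [u] are
    close; their difference is a multiple close to the lattice. *)
Lemma recurrence u (e : R) : 0 < e ->
  exists i k, (0 < i)%N /\ `|u *+ i - intv R k| < e.
Proof.
move=> e0.
have /choice[v_] i : exists v, exists k, u *+ i = v + intv R k /\ (forall j, 0 <= v 0 j < 1).
  by have [v [k ?]] := frac_rV (u *+ i); exists v, k.
move=> /choice[k_ vk].
have FA : (v_ @ \oo) [set u : 'rV[R]_n | forall i, `[0, 1]%classic (u 0 i)].
  exists 0%N => // i _ /= j; have [_ /(_ j)/andP[a b]] := vk i.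
  by rewrite in_itv/= a ltW.
have [p [_ clp]] := @unit_cube_compact (v_ @ \oo) _ FA.
have e2 : 0 < e / 2 by rewrite divr_gt0.
have near N : exists2 i, (N <= i)%N & `|p - v_ i| < e / 2.
  have FN : (v_ @ \oo) (v_ @` [set i | (N <= i)%N]).
    by exists N => // i /= Ni; exists i.
  have [_ [[i /= Ni <-]]] := clp _ _ FN (nbhsx_ballx p _ e2).
  by rewrite -ball_normE/= => H; exists i.
have [i _ Hi] := near 0%N; have [j ij Hj] := near i.+1.
exists (j - i)%N, (k_ j - k_ i); split; first by rewrite subn_gt0.
have [Ei _] := vk i; have [Ej _] := vk j.
have -> : u *+ (j - i) - intv R (k_ j - k_ i) = (p - v_ i) - (p - v_ j).
  rewrite mulrnBr ?(ltnW ij)// Ei Ej intvD intvN !opprD !opprK.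
  by apply/rowP => l; rewrite !mxE; ring.
by apply: (le_lt_trans (ler_normB _ _)); rewrite [e]splitr ltrD.
Qed.

(** Stability under [c] gives stability under positive multiples. For the
    multiple [- i c], take [j c] close to a lattice point: then [u - i c] is
    close to [u - i c + i j c = u + i (j - 1) c] modulo the lattice, which is a
    zero, and continuity concludes. *)
Lemma zero_set_invariant (g : 'rV[R]_n -> R) c u :
  periodic_rV g -> continuous g ->
  (forall v, g v = 0 -> g (v + c) = 0) ->
  g u = 0 -> forall h, closure [set to_torus (c *~ i) | i in [set: int]] h ->
  on_torus g (to_torus u + h) = 0.
Proof.
move=> gP gc gi gu h Hh.
have pos v i : g v = 0 -> g (v + c *+ i) = 0.
  by move=> gv; elim: i => [|i IH]; rewrite ?mulr0n ?addr0// mulrSr addrA gi.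
have neg i : g (u - c *+ i) = 0.
  have [->|i0] := posnP i; first by rewrite mulr0n subr0.
  apply: contrapT => /eqP gi0.
  have e0 : 0 < `|g (u - c *+ i)| by rewrite normr_gt0.
  have /cvgrPdist_lt/(_ _ e0)/nbhs_normP[e /= e1 He] := gc (u - c *+ i).
  have ei : 0 < e / i%:R by rewrite divr_gt0// ltr0n.
  have [j [k [j0 jk]]] := recurrence c ei.
  have := He (u - c *+ i + (c *+ j - intv R k) *+ i); rewrite /ball_/=.
  rewrite opprD addrA subrr sub0r normrN normrMn.
  move/(_ _); rewrite -mulr_natr.
  have -> : g (u - c *+ i + (c *+ j - intv R k) *+ i) = 0.
    have -> : u - c *+ i + (c *+ j - intv R k) *+ i = u + c *+ (j.-1 * i) + intv R (- k *+ i).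
      have -> : intv R (- k *+ i) = - (intv R k *+ i).
        by rewrite intvMn intvN mulNrn.
      rewrite mulrnBl -mulrnA -[in (j * i)%N](prednK j0) mulSn mulrnDr.
      by rewrite !addrA addrNK.
    by rewrite gP pos.
  rewrite subr0 ltxx => H; suff : false by [].
  by apply: H; rewrite -ltr_pdivlMr// ltr0n.
have tc : continuous (fun z : T => on_torus g (to_torus u + z)).
  move=> z; apply: (@continuous_comp _ _ _ (fun z : T => to_torus u + z) (on_torus g)).
    have := @torus_translation_continuous (to_torus u) z.
    by under eq_fun do rewrite addrC.
  exact: on_torus_continuous.
have cl : closed [set z : T | on_torus g (to_torus u + z) = 0].
  apply: (@preimage_closed _ _ (fun z : T => on_torus g (to_torus u + z)) [set 0]).
    by move=> z _; exact: tc.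
  exact: closed_eq.
have : closure [set to_torus (c *~ i) | i in [set: int]] `<=` [set z : T | on_torus g (to_torus u + z) = 0].
  rewrite (iffLR (closure_id _) cl); apply: closure_subset => _ [i _ <-] /=.
  rewrite -to_torusD on_torusE//; case: i => i; first exact: pos.
  by rewrite NegzE mulrNz; exact: neg.
exact.
Qed.

End TorusTopology.

Section LiftHomomorphism.
Variables (R : realType) (n r : nat).

(** If [p] is the largest integer with [p |h|] below the modulus of continuity,
    the images of [h], ..., [p h] all have lifts of norm below 1 / 8. Points of
    norm below 1 / 4 that agree on the torus are equal, so by induction the lift of the
    image of [i h] is [i] times the lift [a] of the image of [h], and the bound
    on [p a] is a bound on [a] proportional to [|h|]. *)
Lemma torus_hom_lipschitz (Psi : torus R r -> torus R n) :
  continuous Psi -> (forall x y, Psi (x + y) = Psi x + Psi y) ->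
  exists e K : R, [/\ 0 < e, 0 <= K & forall h, `|h| <= e ->
    exists2 a, to_torus a = Psi (to_torus h) & `|a| <= K * `|h|].
Proof.
move=> Pc PD.
have P0 : Psi 0 = 0 by apply: (addrI (Psi 0)); rewrite -PD !addr0.
have PM x i : Psi (x *+ i) = Psi x *+ i.
  by elim: i => [|i IH]; rewrite ?mulr0n// !mulrS PD IH.
have e8 : 0 < 8^-1 :> R by [].
have : nbhs (0 : 'rV[R]_r) [set h | exists2 a : 'rV[R]_n, `|a| < 8^-1 & to_torus a = Psi (to_torus h)].
  have c0 : {for (0 : 'rV[R]_r), continuous (Psi \o @to_torus R r)}.
    by apply: continuous_comp; [exact: to_torus_continuous|exact: Pc].
  have N0 : nbhs ((Psi \o @to_torus R r) 0) [set z | exists2 a : 'rV[R]_n, `|a| < 8^-1 & to_torus a = z].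
    by rewrite /= to_torus0 P0; exact: torus_small_nbhs.
  exact: (c0 _ N0).
move=> /nbhs_normP[e0 /= e00 He].
have {He}small h : `|h| <= e0 / 2 -> exists2 a : 'rV[R]_n, `|a| < 8^-1 & to_torus a = Psi (to_torus h).
  move=> he; apply: He; rewrite /ball_/= sub0r normrN (le_lt_trans he)//; lra.
have e0' : 0 < e0 / 2 by rewrite divr_gt0.
(* [p] will satisfy [e0 / 4 < p |h|] and [p |a| < 1 / 8], so that
   [|a| < |h| / (2 e0)] *)
exists (e0 / 2), (e0^-1 * 4); split=> // [|h he]; first by rewrite mulr_ge0// invr_ge0 ltW.
have [->|h0] := eqVneq h 0.
  by exists 0; rewrite ?normr0 ?mulr0// !to_torus0 P0.
have {}h0 : 0 < `|h| by rewrite normr_gt0.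
pose p := Num.truncn (e0 / 2 / `|h|).
have /andP[p1 p2] : p%:R <= e0 / 2 / `|h| < p.+1%:R.
  by apply: truncn_itv; rewrite divr_ge0// ltW.
have ppos : (0 < p)%N.
  by rewrite lt0n; apply: contraTneq p2 => ->; rewrite -leNgt ler_pdivlMr// mul1r.
have hp i : (i <= p)%N -> `|h *+ i| <= e0 / 2.
  move=> ip; have -> : `|h *+ i| = i%:R * `|h| by rewrite normrMn mulr_natl.
  rewrite -ler_pdivlMr//.
  by apply: le_trans p1; rewrite ler_nat.
have [a a8 aE] := small h he.
have aM i : (i <= p)%N -> `|a *+ i| < 8^-1.
  elim: i => [|i IH] ip; first by rewrite mulr0n normr0.
  have {}IH := IH (ltnW ip).
  have [b b8 bE] := small _ (hp _ ip).
  have /to_torusP[k bk] : to_torus b = to_torus (a *+ i.+1).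
    by rewrite bE !to_torusMn PM aE.
  suff k0 : intv R k = 0 by move: bk; rewrite k0 addr0 => <-.
  have kE : intv R k = b - a - a *+ i by rewrite bk mulrS; apply/rowP => l; rewrite !mxE; ring.
  have : `|intv R k| < 1.
    rewrite kE; apply: (le_lt_trans (ler_normB _ _)).
    have := ler_normB b a; lra.
  move=> k1; apply/rowP => l; rewrite !mxE.
  have := le_lt_trans (normr_coord_le (intv R k) l) k1.
  rewrite mxE -intr_norm -[1]/(1%:~R) ltr_int -(add0r 1) ltzD1 normr_le0.
  by move=> /eqP ->.
exists a => //.
have := aM p (leqnn p); have -> : `|a *+ p| = `|a| * p%:R by rewrite normrMn mulr_natr.
move=> ap.
have p2' : p.+1%:R <= 2 * p%:R :> R by rewrite -natrM ler_nat mul2n -addnn -addn1 leq_add2l.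
have p0 : 0 < p%:R :> R by rewrite ltr0n.
rewrite ltr_pdivrMr// in p2.
have H : e0 <= 4 * p%:R * `|h|.
  have : p.+1%:R * `|h| <= 2 * p%:R * `|h| by rewrite ler_wpM2r.
  by move: p2; lra.
have -> : e0^-1 * 4 * `|h| = 4 * `|h| / e0 by ring.
rewrite ler_pdivlMr//; apply: (@le_trans _ _ (`|a| * (4 * p%:R * `|h|))).
  by rewrite ler_wpM2l.
have -> : `|a| * (4 * p%:R * `|h|) = (`|a| * p%:R) * (4 * `|h|) by ring.
apply: (@le_trans _ _ (8^-1 * (4 * `|h|))); first by rewrite ler_wpM2r ?mulr_ge0// ltW.
by rewrite ler_piMl ?mulr_ge0//; lra.
Qed.

End LiftHomomorphism.

(** * Integration over the unit cube *)

Section UnitIntervalIntegral.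
Variable R : realType.
Local Notation mu := (@lebesgue_measure R).
Implicit Types (g h : R -> R).

Lemma continuous_integrable01 g (a b : R) : continuous g -> mu.-integrable `[a, b] (EFin \o g).
Proof.
move=> gc; apply: continuous_compact_integrable; first exact: segment_compact.
exact: continuous_subspaceT.
Qed.

Lemma integral01_linear g h (a : R) : continuous g -> continuous h ->
  \int[mu]_(t in `[0, 1]) (g t + a * h t)
  = \int[mu]_(t in `[0, 1]) g t + a * \int[mu]_(t in `[0, 1]) h t.
Proof.
move=> gc hc.
have ahc : continuous (fun t => a * h t).
  by move=> t; apply: cvgM; [exact: cvg_cst|exact: hc].
rewrite RintegralD//; last 2 first.
- exact: continuous_integrable01.
- exact: continuous_integrable01.
by rewrite RintegralZl//; exact: continuous_integrable01.
Qed.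

Lemma integral01_le g (B : R) : continuous g -> (forall t, `|g t| <= B) ->
  `|\int[mu]_(t in `[0, 1]) g t| <= B.
Proof.
move=> gc gB.
have gi := continuous_integrable01 0 1 gc.
apply: (le_trans (le_normr_Rintegral _ gi)) => //.
have ngc : continuous (fun t => `|g t|).
  by move=> t; apply: continuous_comp; [exact: gc|exact: norm_continuous].
have cB : continuous (fun _ : R => B) by move=> t; exact: cvg_cst.
apply: (@le_trans _ _ (\int[mu]_(t in `[0, 1]) B)).
  by apply: le_Rintegral => //; exact: continuous_integrable01.
by rewrite Rintegral_cst//= lebesgue_measure_itv/= lte01 oppr0 adde0 mulr1.
Qed.

Lemma integral_FTC g F (a b : R) : a < b -> continuous g ->
  (forall t, a <= t <= b -> is_derive t (1 : R) F (g t)) ->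
  \int[mu]_(t in `[a, b]) g t = F b - F a.
Proof.
move=> ab gc dF.
have Fc t : a <= t <= b -> {for t, continuous F}.
  by move=> /dF dFt; apply/differentiable_continuous/derivable1_diffP; apply: ex_derive.
rewrite /Rintegral (@continuous_FTC2 R g F)//.
- exact: continuous_subspaceT.
- split.
  + move=> t; rewrite in_itv/= => /andP[at_ tb]; have := dF t; rewrite !ltW// => /(_ isT) dFt.
    exact: ex_derive.
  + by apply: cvg_at_right_filter; apply: Fc; rewrite lexx ltW.
  + by apply: cvg_at_left_filter; apply: Fc; rewrite lexx ltW.
move=> t; rewrite in_itv/= => /andP[at_ tb]; have := dF t; rewrite !ltW// => /(_ isT) dFt.
by rewrite derive1E derive_val.
Qed.

(** The integral over a period starting at [v] has derivative
    [g (v + 1) - g v = 0] in [v]. *)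
Lemma integral01_shift g (v : R) : continuous g -> (forall t, g (t + 1) = g t) ->
  \int[mu]_(t in `[0, 1]) g (t + v) = \int[mu]_(t in `[0, 1]) g t.
Proof.
move=> gc gP.
(* a base point to the left of every interval considered *)
pose a : R := - `|v| - 2.
pose F (x : R) := \int[mu]_(t in `[a, x]) g t.
have dF (x : R) : a < x -> is_derive x (1 : R) F (g x).
  move=> ax; have xx1 : x < x + 1 by rewrite ltrDl.
  have [|dx Fx] := @continuous_FTC1_closed R g a x (x + 1) xx1 (continuous_integrable01 a (x + 1) gc) ax.
    exact: gc.
  by split; [exact: dx|rewrite -derive1E; exact: Fx].
have dFs (x s : R) : a < x + s -> is_derive x (1 : R) (fun y => F (y + s)) (g (x + s)).
  move=> /dF H.
  have Hs : is_derive x (1 : R) (fun z : R => z + s) 1.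
    have -> : (fun z : R => z + s) = (id + cst s) by [].
    by apply: (is_derive_eq (is_deriveD _ _)); rewrite addr0.
  by apply: (is_derive_eq (@is_derive1_comp _ F (fun z : R => z + s) x _ _ H Hs)); rewrite mulr1.
have av : a < v by rewrite /a; have := ler_norm (- v); rewrite normrN; lra.
have a0 : a < 0 by rewrite /a; have := normr_ge0 v; lra.
have gvc : continuous (fun t => g (t + v)).
  move=> t; apply: (@continuous_comp _ _ _ (fun t => t + v) g); last exact: gc.
  exact: (cvgD cvg_id (cvg_cst _)).
have d1 (t : R) : 0 <= t <= 1 -> is_derive t (1 : R) (fun y => F (y + v)) (g (t + v)).
  by move=> /andP[t0 _]; apply: dFs; lra.
have d2 (t : R) : 0 <= t <= 1 -> is_derive t (1 : R) F (g t).
  by move=> /andP[t0 _]; apply: dF; lra.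
rewrite (integral_FTC ltr01 gvc d1) (integral_FTC ltr01 gc d2).
pose G s := F (s + 1) - F s.
suff : `|G v - G 0| <= 0 * `|v - 0|.
  by rewrite mul0r normr_le0 subr_eq0 => /eqP; rewrite /G !add0r (addrC v 1).
have dG (z : R) : z \in `[Num.min 0 v, Num.max 0 v] -> is_derive z (1 : R) G 0.
  rewrite in_itv/= => /andP[]; rewrite ge_min => /orP z0 _.
  have az : a < z by case: z0; lra.
  have az1 : a < z + 1 by rewrite (lt_le_trans az)// lerDl.
  have H := is_deriveB (dFs z 1 az1) (dF z az).
  by rewrite gP subrr in H; exact: H.
by apply: (mean_value_bound dG) => z _; rewrite normr0.
Qed.

End UnitIntervalIntegral.

Section CubeIntegral.
Variable R : realType.

(** Lipschitz rather than continuous functions are integrated: a slice, and the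
    integral of the slices as a function of the first coordinate, are again
    Lipschitz with the same constant, so no measurability has to be tracked
    through the iterated integral. *)
Definition lipschitz_rV n (C : R) (g : 'rV[R]_n -> R) : Prop :=
  forall u v, `|g u - g v| <= C * `|u - v|.

Lemma lipschitz_rV_continuous_at (V : normedModType R) (C : R) (I : V -> R) (u : V) :
  (forall v, `|u - v| < 1 -> `|I u - I v| <= C * `|u - v|) -> {for u, continuous I}.
Proof.
move=> IC; apply/cvgrPdist_le => e e0.
have C1 : 0 < `|C| + 1 by rewrite ltr_wpDl.
have m0 : 0 < Num.min 1 (e / (`|C| + 1)) by rewrite lt_min ltr01 divr_gt0.
apply: filterS (nbhsx_ballx u _ m0) => v.
rewrite -ball_normE/= lt_min => /andP[uv1 /ltW uve].
apply: (le_trans (IC _ uv1)).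
apply: (@le_trans _ _ ((`|C| + 1) * `|u - v|)).
  by rewrite ler_wpM2r// (le_trans (ler_norm _))// lerDl.
by rewrite mulrC -ler_pdivlMr.
Qed.

Lemma lipschitz_rV_continuous (V : normedModType R) (C : R) (I : V -> R) :
  (forall s t, `|I s - I t| <= C * `|s - t|) -> continuous I.
Proof. by move=> IC t; apply: (@lipschitz_rV_continuous_at V C) => s _. Qed.

(** Integration one coordinate at a time: a point of the cube is its first
    coordinate followed by a point of the cube of lower dimension. *)
Lemma row_mx_sub_norm n (s t : R) (x : 'rV[R]_n) :
  `|row_mx (s%:M : 'rV[R]_1) x - row_mx t%:M x| <= `|s - t|.
Proof.
apply: normr_rV_le => // i; rewrite !mxE; case: splitP => j _; rewrite ?subrr ?normr0//.
by rewrite !mxE !ord1 eqxx !mulr1n.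
Qed.

Lemma lipschitz_rV_row_mx n (C : R) (g : 'rV[R]_n.+1 -> R) (t : R) :
  0 <= C -> lipschitz_rV C g -> lipschitz_rV C (fun x : 'rV[R]_n => g (row_mx (t%:M : 'rV[R]_1) x)).
Proof.
move=> C0 gC u v; apply: (le_trans (gC _ _)); rewrite ler_wpM2l//.
apply: normr_rV_le => // i; rewrite !mxE; case: splitP => j _; rewrite ?subrr ?normr0//.
by have := normr_coord_le (u - v) j; rewrite !mxE.
Qed.

Lemma lipschitz_rV_ge0 n (C : R) (g : 'rV[R]_n.+1 -> R) : lipschitz_rV C g -> 0 <= C.
Proof.
move=> /(_ (const_mx 1) 0); rewrite subr0 => H.
have e : `|const_mx 1 : 'rV[R]_n.+1| = 1.
  apply/eqP; rewrite eq_le; apply/andP; split.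
    by apply: normr_rV_le => // i; rewrite mxE normr1.
  by have := normr_coord_le (const_mx 1 : 'rV[R]_n.+1) 0; rewrite mxE normr1.
by move: H; rewrite e mulr1; apply: le_trans.
Qed.

Lemma lipschitz_rVD n C C' (a : R) (g h : 'rV[R]_n -> R) : lipschitz_rV C g -> lipschitz_rV C' h ->
  lipschitz_rV (C + `|a| * C') (fun x => g x + a * h x).
Proof.
move=> gC hC u v.
have -> : g u + a * h u - (g v + a * h v) = (g u - g v) + a * (h u - h v) by ring.
rewrite mulrDl; apply: (le_trans (ler_normD _ _)); apply: lerD; first exact: gC.
by rewrite normrM -mulrA ler_wpM2l// hC.
Qed.

(** Linearity and boundedness are proved together: both are needed, in lower
    dimension, to see that the inner integral is Lipschitz in the outer
    variable. *)
Lemma cube_integral_linear_le n :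
  (forall (g h : 'rV[R]_n -> R) C C' a, lipschitz_rV C g -> lipschitz_rV C' h ->
     cube_integral (fun x => g x + a * h x) = cube_integral g + a * cube_integral h) /\
  (forall (g : 'rV[R]_n -> R) C B, lipschitz_rV C g -> (forall x, `|g x| <= B) ->
     `|cube_integral g| <= B).
Proof.
elim: n => [|n [IHl IHb]]; first by split=> [g h C C' a _ _ //|g C B _ gB]; exact: gB.
have ic (g : 'rV[R]_n.+1 -> R) C : lipschitz_rV C g -> continuous (fun t : R =>
    cube_integral (fun x : 'rV[R]_n => g (row_mx (t%:M : 'rV[R]_1) x))).
  move=> gC; have C0 := lipschitz_rV_ge0 gC.
  apply: (@lipschitz_rV_continuous R C) => s t.
  have -> : cube_integral (fun x : 'rV[R]_n => g (row_mx (s%:M : 'rV[R]_1) x))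
      - cube_integral (fun x : 'rV[R]_n => g (row_mx (t%:M : 'rV[R]_1) x))
    = cube_integral (fun x : 'rV[R]_n => g (row_mx (s%:M : 'rV[R]_1) x)
                       + (-1) * g (row_mx (t%:M : 'rV[R]_1) x)).
    by rewrite (IHl _ _ C C)//; [rewrite mulN1r|exact: lipschitz_rV_row_mx|exact: lipschitz_rV_row_mx].
  apply: (IHb _ (C + `|-1| * C)).
    by apply: lipschitz_rVD; exact: lipschitz_rV_row_mx.
  move=> x; rewrite mulN1r; apply: (le_trans (gC _ _)).
  by rewrite ler_wpM2l// row_mx_sub_norm.
split=> [g h C C' a gC hC'|g C B gC gB] /=.
  have C0 := lipschitz_rV_ge0 gC; have C'0 := lipschitz_rV_ge0 hC'.
  rewrite -integral01_linear; [|exact: (ic _ _ gC)|exact: (ic _ _ hC')].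
  apply: eq_Rintegral => t _; apply: (IHl _ _ C C'); exact: lipschitz_rV_row_mx.
apply: integral01_le; first exact: (ic _ _ gC).
move=> t; apply: (IHb _ C) => //; apply: lipschitz_rV_row_mx => //; exact: lipschitz_rV_ge0 gC.
Qed.

(** One coordinate at a time: the inner integral absorbs the shift of the last
    coordinates by induction, and is a periodic function of the first one. *)
Lemma cube_integral_shift n (g : 'rV[R]_n -> R) C v : lipschitz_rV C g -> periodic_rV g ->
  cube_integral (fun x => g (x + v)) = cube_integral g.
Proof.
elim: n g v => [|n IH] g v gC gP; first by rewrite /= [0 + v]thinmx0.
rewrite /=.
have C0 := lipschitz_rV_ge0 gC.
pose v0 := lsubmx (v : 'rV[R]_(1 + n)) 0 0; pose v1 : 'rV[R]_n := rsubmx (v : 'rV[R]_(1 + n)).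
pose I (t : R) := cube_integral (fun x : 'rV[R]_n => g (row_mx (t%:M : 'rV[R]_1) x)).
have vE : v = row_mx (v0%:M : 'rV[R]_1) v1.
  by rewrite /v0 /v1 -mx11_scalar hsubmxK.
have addE (t : R) (x : 'rV[R]_n) :
    row_mx (t%:M : 'rV[R]_1) x + v = row_mx ((t + v0)%:M : 'rV[R]_1) (x + v1).
  by rewrite {1}vE add_row_mx raddfD.
have gPt (t : R) : periodic_rV (fun x : 'rV[R]_n => g (row_mx (t%:M : 'rV[R]_1) x)).
  move=> x k; rewrite -[in RHS](gP _ (row_mx (0 : 'rV_1) k)); congr g.
  by apply/rowP => i; rewrite !mxE; case: splitP => j _; rewrite !mxE ?addr0.
transitivity (\int[@lebesgue_measure R]_(t in `[0, 1]) I (t + v0)).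
  apply: eq_Rintegral => t _.
  transitivity (cube_integral (fun x : 'rV[R]_n => g (row_mx ((t + v0)%:M : 'rV[R]_1) (x + v1)))).
    by congr cube_integral; apply/funext => x; rewrite addE.
  exact: (IH (fun x : 'rV[R]_n => g (row_mx ((t + v0)%:M : 'rV[R]_1) x)) v1 (lipschitz_rV_row_mx _ C0 gC) (gPt _)).
have [IHl IHb] := cube_integral_linear_le n.
apply: integral01_shift.
  apply: (@lipschitz_rV_continuous R C) => s t.
  have -> : I s - I t = cube_integral (fun x : 'rV[R]_n => g (row_mx (s%:M : 'rV[R]_1) x)
                       + (-1) * g (row_mx (t%:M : 'rV[R]_1) x)).
    by rewrite (IHl _ _ C C)//; [rewrite mulN1r|exact: lipschitz_rV_row_mx|exact: lipschitz_rV_row_mx].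
  apply: (IHb _ (C + `|-1| * C)).
    by apply: lipschitz_rVD; exact: lipschitz_rV_row_mx.
  move=> x; rewrite mulN1r; apply: (le_trans (gC _ _)).
  by rewrite ler_wpM2l// row_mx_sub_norm.
move=> t; congr cube_integral; apply/funext => x.
rewrite -[RHS](gP _ (row_mx (1%:M : 'rV_1) 0)); congr g.
apply/rowP => i; rewrite !mxE; case: splitP => j _; rewrite !mxE ?addr0//.
by rewrite !ord1 eqxx !mulr1n.
Qed.

End CubeIntegral.

(** * Fourier coefficients *)

Section FourierCoefficients.
Variables (R : realType) (r : nat).
Implicit Types (g h : 'rV[R]_r -> R) (k : 'rV[int]_r) (v w : 'rV[R]_r).

(** What is needed to multiply by a character and integrate: a product of bounded
    Lipschitz functions is Lipschitz. *)
Definition tame g : Prop :=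
  [/\ periodic_rV g, (exists C, lipschitz_rV C g) & exists B, forall x, `|g x| <= B].

Definition cube_fourier k g : R[i] :=
  ccube_integral (fun x => (g x)%:C * e2pi (- dotp (intv R k) x)).

Let phase k x : R := 2 * pi * - dotp (intv R k) x.

Lemma cube_fourierE k g : cube_fourier k g =
  cube_integral (fun x => g x * cos (phase k x)) +i*
  cube_integral (fun x => g x * sin (phase k x)).
Proof.
rewrite /cube_fourier /ccube_integral; congr (_ +i* _);
  congr cube_integral; apply/funext => x; rewrite /e2pi /phase; simpc => //=.
Qed.

Lemma dist_cos_le (s t : R) : `|cos s - cos t| <= `|s - t|.
Proof.
rewrite -[leRHS]mul1r.
apply: (@mean_value_bound R cos (fun z => - sin z)) => z _.
by rewrite normrN ler_norml sin_geN1 sin_le1.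
Qed.

Lemma sin_cos_shift (t : R) : sin t = cos (t - pi / 2).
Proof. by rewrite cosBpihalf. Qed.

Lemma dist_sin_le (s t : R) : `|sin s - sin t| <= `|s - t|.
Proof.
by rewrite !sin_cos_shift; apply: (le_trans (dist_cos_le _ _)); rewrite opprB addrA subrK.
Qed.

Lemma lipschitz_rV_phase k : exists C, lipschitz_rV C (phase k).
Proof.
exists (2 * pi * (r%:R * lattice_size R k)) => u v.
rewrite /phase.
have -> : 2 * pi * - dotp (intv R k) u - 2 * pi * - dotp (intv R k) v
  = - (2 * pi * dotp (u - v) (intv R k)).
  by rewrite dotpDl dotpNl !(dotpC _ (intv R k)); ring.
rewrite normrN normrM ger0_norm ?mulr_ge0 ?pi_ge0// -!mulrA ler_wpM2l// ler_wpM2l ?pi_ge0//.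
by rewrite mulrA normr_dotp_le.
Qed.

Lemma lipschitz_rV_tameM g (trig : R -> R) k : tame g ->
  (forall s, `|trig s| <= 1) -> (forall s t, `|trig s - trig t| <= `|s - t|) ->
  exists C, lipschitz_rV C (fun x => g x * trig (phase k x)).
Proof.
move=> [_ [C gC] [B gB]] t1 tl; have [D kD] := lipschitz_rV_phase k.
exists (C + B * D) => u v.
have -> : g u * trig (phase k u) - g v * trig (phase k v)
  = (g u - g v) * trig (phase k u) + g v * (trig (phase k u) - trig (phase k v)) by ring.
rewrite [leRHS]mulrDl; apply: (le_trans (ler_normD _ _)); rewrite !normrM; apply: lerD.
  by rewrite -[leRHS]mulr1 ler_pM.
by rewrite -mulrA ler_pM//; apply: (le_trans (tl _ _)); exact: kD.
Qed.

Lemma lipschitz_rV_tame_cos g k : tame g -> exists C, lipschitz_rV C (fun x => g x * cos (phase k x)).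
Proof.
move=> gt; apply: lipschitz_rV_tameM => // [s|s t]; last exact: dist_cos_le.
by rewrite ler_norml cos_geN1 cos_le1.
Qed.

Lemma lipschitz_rV_tame_sin g k : tame g -> exists C, lipschitz_rV C (fun x => g x * sin (phase k x)).
Proof.
move=> gt; apply: lipschitz_rV_tameM => // [s|s t]; last exact: dist_sin_le.
by rewrite ler_norml sin_geN1 sin_le1.
Qed.

Lemma tame_shift g w : tame g -> tame (fun x => g (x + w)).
Proof.
move=> [gP [C gC] [B gB]]; split.
- by move=> x k; rewrite addrAC gP.
- exists C => u v; apply: (le_trans (gC _ _)).
  by rewrite opprD addrACA subrr addr0.
- by exists B.
Qed.

Lemma tameB g h : tame g -> tame h -> tame (fun x => g x - h x).
Proof.
move=> [gP [C gC] [B gB]] [hP [C' hC] [B' hB]]; split.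
- by move=> x k; rewrite gP hP.
- exists (C + `|-1| * C'); have := lipschitz_rVD (-1) gC hC.
  by under eq_fun do rewrite mulN1r.
- by exists (B + B') => x; apply: (le_trans (ler_normB _ _)); exact: lerD.
Qed.

Lemma cube_fourierB k g h : tame g -> tame h ->
  cube_fourier k (fun x => g x - h x) = cube_fourier k g - cube_fourier k h.
Proof.
move=> gt ht; rewrite !cube_fourierE.
have [C1 gc] := lipschitz_rV_tame_cos k gt; have [C2 hc] := lipschitz_rV_tame_cos k ht.
have [C3 gs] := lipschitz_rV_tame_sin k gt; have [C4 hs] := lipschitz_rV_tame_sin k ht.
have [L _] := @cube_integral_linear_le R r.
simpc; congr (_ +i* _).
  by rewrite -mulN1r -(L _ _ _ _ _ gc hc); congr cube_integral; apply/funext => x; ring.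
by rewrite -mulN1r -(L _ _ _ _ _ gs hs); congr cube_integral; apply/funext => x; ring.
Qed.

Lemma cube_fourier_le k g B : tame g -> (forall x, `|g x| <= B) ->
  cmod (cube_fourier k g) <= 2 * B.
Proof.
move=> gt gB; rewrite cube_fourierE; apply: (le_trans (cmod_le_ReIm _)) => /=.
have [C1 gc] := lipschitz_rV_tame_cos k gt; have [C3 gs] := lipschitz_rV_tame_sin k gt.
have [_ L] := @cube_integral_linear_le R r.
rewrite mulr_natl mulr2n; apply: lerD.
  apply: (L _ _ _ gc) => x; rewrite normrM -[leRHS]mulr1 ler_pM//.
  by rewrite ler_norml cos_geN1 cos_le1.
apply: (L _ _ _ gs) => x; rewrite normrM -[leRHS]mulr1 ler_pM//.
by rewrite ler_norml sin_geN1 sin_le1.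
Qed.

Lemma phase_periodic_cos k : periodic_rV (fun x => cos (phase k x)).
Proof.
move=> x m.
have := @e2pi_addint R (- dotp (intv R k) x) (- dotp (intv R k) (intv R m)).
rewrite rpredN dotp_intv_int -opprD -dotpDr => /(_ isT) [H _].
exact: H.
Qed.

Lemma phase_periodic_sin k : periodic_rV (fun x => sin (phase k x)).
Proof.
move=> x m.
have := @e2pi_addint R (- dotp (intv R k) x) (- dotp (intv R k) (intv R m)).
rewrite rpredN dotp_intv_int -opprD -dotpDr => /(_ isT) [_ H].
exact: H.
Qed.

(** Translate the integrand back: the character then picks up the factor, which
    in real terms is a rotation of its cosine and sine parts. *)
Lemma cube_fourier_shift k g w : tame g ->
  cube_fourier k (fun x => g (x + w)) = e2pi (dotp (intv R k) w) * cube_fourier k g.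
Proof.
move=> gt; have [gP _ _] := gt.
have [C1 gc] := lipschitz_rV_tame_cos k gt; have [C3 gs] := lipschitz_rV_tame_sin k gt.
have [L _] := @cube_integral_linear_le R r.
have pgc : periodic_rV (fun x => g x * cos (phase k x)).
  by move=> x m; rewrite gP phase_periodic_cos.
have pgs : periodic_rV (fun x => g x * sin (phase k x)).
  by move=> x m; rewrite gP phase_periodic_sin.
pose a := 2 * pi * dotp (intv R k) w.
have kw x : phase k x = phase k (x + w) + a by rewrite /phase /a dotpDr; ring.
have lin (a1 a2 : R) :
    cube_integral (fun x => a1 * (g x * cos (phase k x)) + a2 * (g x * sin (phase k x)))
  = a1 * cube_integral (fun x => g x * cos (phase k x))
    + a2 * cube_integral (fun x => g x * sin (phase k x)).
  have gc1 : lipschitz_rV (0 + `|a1| * C1) (fun x => a1 * (g x * cos (phase k x))).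
    have c0 : lipschitz_rV 0 (fun _ : 'rV[R]_r => 0 : R) by move=> u v; rewrite subrr normr0 mul0r.
    by have := lipschitz_rVD a1 c0 gc; under eq_fun do rewrite add0r.
  rewrite (L _ _ _ _ _ gc1 gs); congr (_ + _).
  have c0 : lipschitz_rV 0 (fun _ : 'rV[R]_r => 0 : R) by move=> u v; rewrite subrr normr0 mul0r.
  have := L _ _ _ _ a1 c0 gc; under eq_fun do rewrite add0r.
  move=> ->; rewrite (_ : cube_integral _ = 0) ?add0r//.
  have := L _ _ _ _ (-1) c0 c0; under eq_fun do rewrite mulr0 addr0.
  by rewrite mulN1r subrr.
have lc (a1 a2 : R) : exists C, lipschitz_rV C (fun x => a1 * (g x * cos (phase k x)) + a2 * (g x * sin (phase k x))).
  have c0 : lipschitz_rV 0 (fun _ : 'rV[R]_r => 0 : R) by move=> u v; rewrite subrr normr0 mul0r.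
  have := lipschitz_rVD a1 c0 gc; under eq_fun do rewrite add0r.
  by move=> H; exists (0 + `|a1| * C1 + `|a2| * C3); exact: lipschitz_rVD H gs.
have pp (a1 a2 : R) : periodic_rV (fun x => a1 * (g x * cos (phase k x)) + a2 * (g x * sin (phase k x))).
  by move=> x m; rewrite pgc pgs.
rewrite !cube_fourierE /e2pi -/a; simpc; congr (_ +i* _).
  rewrite -mulNr -lin; have [C HC] := lc (cos a) (- sin a).
  rewrite -(cube_integral_shift w HC (pp _ _)); congr cube_integral; apply/funext => x.
  by rewrite kw cosD; ring.
rewrite addrC -lin; have [C HC] := lc (sin a) (cos a).
rewrite -(cube_integral_shift w HC (pp _ _)); congr cube_integral; apply/funext => x.
by rewrite kw sinD; ring.
Qed.

Lemma tame_fdiff g w N : tame g -> tame (iter N (fdiff w) g).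
Proof.
move=> gt; elim: N => [//|N IH]; rewrite iterS.
by apply: tameB => //; exact: tame_shift.
Qed.

(** Translating by half a period of the character [k] changes its sign, so each
    difference multiplies the coefficient by -2. *)
Lemma cube_fourier_fdiff k g w N : tame g -> dotp (intv R k) w = 2^-1 ->
  cube_fourier k (iter N (fdiff w) g) = (- 2) ^+ N * cube_fourier k g.
Proof.
move=> gt kw; elim: N => [|N IH]; first by rewrite expr0 mul1r.
have H := tame_fdiff w N gt.
rewrite iterS [fdiff w _]/fdiff cube_fourierB//; last exact: tame_shift.
rewrite cube_fourier_shift// kw IH.
have -> : e2pi (2^-1 : R) = -1.
  rewrite /e2pi mulrAC divff// mul1r cospi sinpi.
  by apply/eqP; rewrite eq_complex/= oppr0 !eqxx.
by rewrite exprS; ring.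
Qed.

Lemma eucl_norm_le (u : 'rV[R]_r) (K : R) : 0 <= K -> (forall i, `|u 0 i| <= K) ->
  eucl_norm u <= r%:R * K.
Proof.
move=> K0 uK; rewrite /eucl_norm -[leRHS]ger0_norm ?mulr_ge0// -sqrtr_sqr ler_wsqrtr//.
apply: (@le_trans _ _ (\sum_(i < r) K ^+ 2)).
  apply: ler_sum => i _; rewrite -expr2 -real_normK ?num_real// lerXn2r ?nnegrE//.
rewrite sumr_const card_ord exprMn.
have -> : K ^+ 2 *+ r = r%:R * K ^+ 2 by rewrite mulr_natl.
rewrite ler_wpM2r ?sqr_ge0//.
by rewrite -natrX ler_nat; case: (r) => // n; rewrite expnS expn1 leq_pmull.
Qed.

(** Let [j] be a coordinate where [|k|] is largest. The step
    [delta_j / (2 k_j)] is half a period of the character and has norm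
    [1 / (2 |k_j|)], and [|k_j|] is comparable to the norm of [k]. *)
Lemma fourier_decay g : tame g ->
  (forall N, exists C, forall v w, `|iter N (fdiff w) g v| <= C * `|w| ^+ N) ->
  forall N, exists C, forall k, k != 0 ->
    (1 + eucl_norm (intv R k)) ^+ N * cmod (cube_fourier k g) <= C.
Proof.
move=> gt gN N; have [C CP] := gN N.
exists ((1 + r%:R) ^+ N * (2 * `|C|)) => k k0.
have [j0 kj0] : exists j, k 0 j != 0.
  apply/existsP; apply: contraNT k0 => /existsPn H; apply/eqP/rowP => j.
  by rewrite mxE; apply/eqP; have := H j; rewrite negbK.
have [j _ jmax] : exists2 j, true & forall i, (`|k ord0 i| <= `|k ord0 j|)%N.
  by case: (@arg_maxnP _ j0 xpredT (fun i => `|k ord0 i|%N) isT) => j _ H; exists j => // i; exact: H.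
pose K : R := `|(k 0 j)%:~R|.
have kK i : `|(k 0 i)%:~R| <= K :> R by rewrite /K -!intr_norm ler_int -!abszE lez_nat; exact: jmax.
have K1 : 1 <= K.
  by apply: le_trans (kK j0); rewrite -intr_norm -[1]/(1%:~R) ler_int -abszE lez_nat absz_gt0.
have K0 : 0 < K by exact: lt_le_trans K1.
have kn0 : (k 0 j)%:~R != 0 :> R by rewrite -normr_gt0.
pose w : 'rV[R]_r := (2 * (k 0 j)%:~R)^-1 *: delta_mx 0 j.
have kw : dotp (intv R k) w = 2^-1.
  rewrite /dotp (bigD1 j)//= big1 ?addr0 => [|i ij]; last by rewrite !mxE (negPf ij) andbF !mulr0.
  by rewrite !mxE !eqxx mulr1; field.
have wK : `|w| <= (2 * K)^-1.
  apply: normr_rV_le => [|i]; first by rewrite invr_ge0 mulr_ge0// ltW.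
  rewrite !mxE normrM normfV normrM ger0_norm// -/K.
  by rewrite ler_piMr ?invr_ge0 ?mulr_ge0 ?(ltW K0)//; case: (_ && _); rewrite ?normr1 ?normr0.
have H := cube_fourier_fdiff N gt kw.
have : 2 ^+ N * cmod (cube_fourier k g) <= 2 * (`|C| * (2 * K) ^- N).
  have -> : 2 ^+ N * cmod (cube_fourier k g) = cmod (cube_fourier k (iter N (fdiff w) g)).
    rewrite H cmodM; congr (_ * _).
    elim: (N) => [|n IH]; first by rewrite !expr0 /cmod Normc.normc1.
    rewrite !exprS cmodM -IH; congr (_ * _).
    by apply: (@complexI R); rewrite -normr_cmod normrN normr_nat rmorph_nat.
  apply: cube_fourier_le; first exact: tame_fdiff.
  move=> x; apply: (le_trans (CP x w)).
  apply: (@le_trans _ _ (`|C| * `|w| ^+ N)); first by rewrite ler_wpM2r ?exprn_ge0// ler_norm.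
  by rewrite ler_wpM2l// -exprVn lerXn2r ?nnegrE// invr_ge0 mulr_ge0// ltW.
rewrite exprMn; move: (cmod _) (cmod_ge0 (cube_fourier k g)) => c c0 Hc.
have E : (1 + eucl_norm (intv R k)) ^+ N <= (1 + r%:R) ^+ N * K ^+ N.
  rewrite -exprMn lerXn2r ?nnegrE ?addr_ge0 ?sqrtr_ge0 ?mulr_ge0 ?(ltW K0)//.
  have H1 : eucl_norm (intv R k) <= r%:R * K.
    by apply: eucl_norm_le => [|i]; [exact: ltW|rewrite mxE].
  by rewrite [leRHS]mulrDl mul1r lerD.
apply: (le_trans (ler_wpM2r c0 E)).
rewrite -mulrA ler_wpM2l ?exprn_ge0 ?addr_ge0//.
have p2 : 1 <= 2 ^+ N :> R by rewrite exprn_ege1// ler1n.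
have KN : 0 < K ^+ N by rewrite exprn_gt0.
apply: (@le_trans _ _ (K ^+ N * (2 ^+ N * c))).
  by rewrite (ler_wpM2l (ltW KN))// ler_peMl.
apply: (le_trans (ler_wpM2l (ltW KN) Hc)).
have -> : K ^+ N * (2 * (`|C| / (2 ^+ N * K ^+ N))) = 2 * `|C| / 2 ^+ N.
  move: (K ^+ N) (2 ^+ N) KN p2 => x y x0 y1.
  by field; rewrite (gt_eqF x0) gt_eqF ?(lt_le_trans ltr01).
by rewrite ler_pdivrMr ?exprn_gt0// ler_peMr// mulr_ge0.
Qed.

End FourierCoefficients.

(** * Closures of cyclic subgroups of the torus *)

Section MonotheticGroup.
Variables (R : realType) (n : nat).
Local Notation T := (torus R n).
Implicit Types (z w g : T) (K : set T).

Definition subgroup K : Prop := [/\ K 0, forall z w, K z -> K w -> K (z + w)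
  & forall z, K z -> K (- z)].

Definition multiples g : set T := [set g *~ i | i in [set: int]].

Lemma subgroup_mulrn K z i : subgroup K -> K z -> K (z *+ i).
Proof.
move=> [K0 KD _] Kz; elim: i => [|i IH]; first by rewrite mulr0n.
by rewrite mulrS; exact: KD.
Qed.

Lemma subgroup_mulrz K z (i : int) : subgroup K -> K z -> K (z *~ i).
Proof.
move=> Ks Kz; case: i => i; first exact: subgroup_mulrn.
by rewrite NegzE mulrNz; case: (Ks) => _ _; apply; exact: subgroup_mulrn.
Qed.

Lemma subgroupB K z w : subgroup K -> K z -> K w -> K (z - w).
Proof. by move=> [_ KD KN] Kz Kw; apply: KD => //; exact: KN. Qed.

Lemma closure_image_sub (f : T -> T) (A B : set T) : continuous f -> closed B ->
  (forall z, A z -> B (f z)) -> forall z, closure A z -> B (f z).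
Proof.
move=> fc Bc AB.
have cl : closed (f @^-1` B) by apply: preimage_closed => // z _; exact: fc.
move=> z; rewrite -[B (f z)]/((f @^-1` B) z) (iffLR (closure_id _) cl).
by move: z; apply: closure_subset.
Qed.

Lemma subgroup_closure K : subgroup K -> subgroup (closure K).
Proof.
move=> [K0 KD KN].
have cK : closed (closure K) by exact: closed_closure.
split; first exact: subset_closure.
- move=> z w Kz Kw.
  apply: (closure_image_sub (@torus_translation_continuous R n w) cK) Kz => u Ku.
  rewrite addrC.
  apply: (closure_image_sub (@torus_translation_continuous R n u) cK) Kw => v Kv.
  by apply: subset_closure; rewrite addrC; exact: KD.
apply: (closure_image_sub (@torus_opp_continuous R n) cK) => z Kz.
by apply: subset_closure; exact: KN.
Qed.

Lemma subgroup_multiples g : subgroup (multiples g).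
Proof.
split; first by exists 0.
- by move=> _ _ [i _ <-] [j _ <-]; exists (i + j) => //; rewrite mulrzDr.
by move=> _ [i _ <-]; exists (- i) => //; rewrite mulrNz.
Qed.

(** Translates and opposites of the component are connected, and each meets the
    component of the point at hand. *)
Lemma subgroup_component K : subgroup K -> subgroup (connected_component K 0).
Proof.
move=> Ks; have [K0 KD KN] := Ks.
have C0 : connected_component K 0 0 by exact: connected_component_refl.
have img (f : T -> T) : continuous f -> connected (f @` connected_component K 0).
  move=> fc; apply: connected_continuous_connected; first exact: component_connected.
  exact: continuous_subspaceT.
split => // [z w Cz Cw|z Cz].
- have Kw := connected_component_sub Cw.
  have sub : [set u + w | u in connected_component K 0] `<=` connected_component K w.
    apply: connected_component_max.
    + by exists 0; rewrite ?add0r.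
    + by move=> _ [u /connected_component_sub Ku <-]; exact: KD.
    exact: (img _ (@torus_translation_continuous R n w)).
  have zw : connected_component K w (z + w) by apply: sub; exists z.
  exact: connected_component_trans Cw zw.
have sub : [set - u | u in connected_component K 0] `<=` connected_component K 0.
  apply: connected_component_max.
  + by exists 0; rewrite ?oppr0.
  + by move=> _ [u /connected_component_sub Ku <-]; exact: KN.
  exact: (img _ (@torus_opp_continuous R n)).
by apply: sub; exists z.
Qed.

(** Finitely many cosets of a closed subgroup form a closed set, so if they
    contain the multiples of [g] they contain their closure. *)
Lemma closure_multiples_cosets K g (q : nat) : subgroup K -> closed K ->
  (0 < q)%N -> K (g *+ q) ->
  forall h, closure (multiples g) h ->
    exists2 i : nat, (i < q)%N & K (h - g *+ i).
Proof.
move=> Ks cK q0 Kq.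
pose U := \big[setU/set0]_(i <- iota 0 q) [set h | K (h - g *+ i)].
have cU : closed U.
  apply: closed_bigsetU => i _.
  apply: (@preimage_closed T T (fun h : T => h - g *+ i) K) => // z _.
  exact: torus_translation_continuous.
have UE h : U h <-> exists2 i : nat, (i < q)%N & K (h - g *+ i).
  rewrite /U -bigcup_seq /=; split=> [[i /=]|[i iq Ki]].
    by rewrite mem_iota add0n => iq Ki; exists i.
  by exists i => //=; rewrite mem_iota add0n.
have sub : (multiples g) `<=` U.
  move=> _ [j _ <-]; apply/UE.
  have qz : (q%:Z != 0)%R by rewrite eqz_nat -lt0n.
  exists `|(j %% q)%Z|%N.
    by rewrite -ltz_nat gez0_abs ?modz_ge0// ltz_pmod// ltz_nat.
  have -> : g *~ j - g *+ `|(j %% q)%Z| = (g *+ q) *~ (j %/ q)%Z.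
    rewrite {1}(divz_eq j q) mulrzDr pmulrn gez0_abs ?modz_ge0//.
    by rewrite addrK mulrC mulrzA -pmulrn.
  exact: subgroup_mulrz.
move=> h; have /closure_id UE' := cU.
by move=> /(closure_subset sub); rewrite -UE' => /UE.
Qed.

Lemma coset_eqP K z w : subgroup K ->
  [set z + u | u in K] = [set w + u | u in K] <-> K (z - w).
Proof.
move=> Ks; have [K0 KD KN] := Ks; split.
  move=> E; have : [set w + u | u in K] z by rewrite -E; exists 0; rewrite ?addr0.
  by move=> [u Ku <-]; rewrite addrAC subrr add0r.
move=> Kzw; apply/seteqP; split=> _ [u Ku <-].
  exists ((z - w) + u); first exact: KD.
  by rewrite addrA (addrC w) subrK.
exists (- (z - w) + u); last by rewrite opprB addrA (addrC z) subrK.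
by apply: KD => //; exact: KN.
Qed.

(** By pigeonhole some positive multiple of [g] lies in [K]; if [q] is the least
    one, the cosets of [g *+ i], [i < q], are distinct and exhaust the closure,
    so [q] is the number of cosets. *)
Lemma cosets_multiples K g (m : nat) : subgroup K -> closed K ->
  let H := closure (multiples g) in
  (cosets H K #= `I_m)%card ->
  [/\ (0 < m)%N, K (g *+ m) & forall i, (0 < i < m)%N -> ~ K (g *+ i)].
Proof.
move=> Ks cK H Hm.
have Hs : subgroup H by apply: subgroup_closure; exact: subgroup_multiples.
have Hg i : H (g *+ i).
  by apply: (@subgroup_mulrn H g i Hs); apply: subset_closure; exists 1.
pose c (i : nat) := [set g *+ i + u | u in K].
have cH i : cosets H K (c i) by exists (g *+ i).
have [q [q0 Kq qmin]] : exists q, [/\ (0 < q)%N, K (g *+ q) &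
    forall i, (0 < i < q)%N -> ~ K (g *+ i)].
  have [i i0 Ki] : exists2 i, (0 < i)%N & K (g *+ i).
    apply: contrapT => Hno.
    have inj : {in `I_m.+1 &, injective c}.
      move=> i j _ _ /(coset_eqP _ _ Ks) Kij; apply/eqP; apply: contrapT => /negP ij.
      apply: Hno; have [lij|lji|eij] := ltngtP i j; last by rewrite eij eqxx in ij.
        exists (j - i)%N; first by rewrite subn_gt0.
        by rewrite mulrnBr ?(ltnW lij)// -opprB; have [_ _] := Ks; apply.
      by exists (i - j)%N; rewrite ?subn_gt0// mulrnBr// ltnW.
    have := inj_card_eq inj => E.
    have : (`I_m.+1 #<= `I_m)%card.
      apply: (card_le_trans (B := cosets H K)); last by rewrite card_eq_le in Hm; case/andP: Hm.
      apply: (card_le_trans (B := c @` `I_m.+1)).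
        by rewrite card_eq_le in E; case/andP: E.
      by apply: subset_card_le => _ [i _ <-]; exact: cH.
    by rewrite card_le_II ltnn.
  have ex : exists i, (0 < i)%N && `[< K (g *+ i) >] by exists i; rewrite i0; apply/asboolP.
  case: (ex_minnP ex) => q /andP[q0 /asboolP Kq] qmin; exists q; split => // j /andP[j0 jq] Kj.
  by have := qmin j; rewrite j0 leqNgt jq/= => H'; suff: false by []; apply: H'; apply/asboolP.
have inj : {in `I_q &, injective c}.
  move=> i j; rewrite !inE/= => iq jq /(coset_eqP _ _ Ks) Kij.
  have [lij|lji|//] := ltngtP i j.
    case: (qmin (j - i)%N); first by rewrite subn_gt0 lij (leq_ltn_trans (leq_subr _ _)).
    by rewrite mulrnBr ?(ltnW lij)// -opprB; have [_ _] := Ks; apply.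
  case: (qmin (i - j)%N); first by rewrite subn_gt0 lji (leq_ltn_trans (leq_subr _ _)).
  by rewrite mulrnBr// ltnW.
have cE : c @` `I_q = cosets H K.
  apply/seteqP; split=> [_ [i _ <-]|_ [h Hh <-]]; first exact: cH.
  have [i iq Ki] := closure_multiples_cosets Ks cK q0 Kq Hh.
  by exists i => //; apply/esym/coset_eqP.
have := inj_card_eq inj; rewrite cE => E.
have Em : (`I_q #= `I_m)%card by exact: card_eq_trans (card_esym E) Hm.
by move/card_eq_II: Em => <-.
Qed.

End MonotheticGroup.

Section DenseCharacter.
Variables (R : realType) (n r : nat).

Definition torus_char (k : 'rV[int]_r) (w : torus R r) : R[i] := e2pi (tpair k w).

Lemma torus_char_to_torus k (u : 'rV[R]_r) :
  torus_char k (to_torus u) = e2pi (dotp (intv R k) u).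
Proof.
apply: (on_torusE (g := fun u => e2pi (dotp (intv R k) u))) => v l.
by rewrite dotpDr e2pi_addint// dotp_intv_int.
Qed.

Lemma torus_charD k (z w : torus R r) :
  torus_char k (z + w) = torus_char k z * torus_char k w.
Proof.
rewrite -(to_torus_repr z) -(to_torus_repr w) -to_torusD !torus_char_to_torus.
by rewrite dotpDr e2piD.
Qed.

(** The real part decides whether a character is 1 ([e2pi_Re1]), so that its
    kernel is closed. *)
Lemma torus_char_Re_continuous k : continuous (fun w => complex.Re (torus_char k w)).
Proof.
apply: torus_continuous.
have [C kC] := lipschitz_rV_phase R k.
apply: (@lipschitz_rV_continuous _ _ C) => u v.
have E w : complex.Re (torus_char k (to_torus w)) = cos (2 * pi * - dotp (intv R k) w).
  by rewrite torus_char_to_torus /= mulrN cosN.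
have H := le_trans (dist_cos_le _ _) (kC u v).
by rewrite -!E in H; exact: H.
Qed.

Lemma e2pi_Re1 (t : R) : complex.Re (e2pi t) = 1 -> e2pi t = 1.
Proof.
move=> /= c1; have := cos2Dsin2 (2 * pi * t); rewrite c1 expr1n => /eqP.
rewrite -subr_eq0 addrAC subrr add0r sqrf_eq0 => /eqP s0.
by rewrite /e2pi c1 s0.
Qed.

(** Otherwise the kernel [B] of the character on [A] is a closed subgroup
    containing [g *+ m]. Its translates by [g *+ i], [i < m], cover [A], and only
    [i = 0] can occur because the other [g *+ i] lie outside [A]. So the
    character is trivial, against [k != 0]. *)
Lemma torus_char_neq1 k (A : set (torus R n)) g Phi Psi (m : nat) :
  subgroup A -> closed A -> torus_iso A Phi Psi ->
  A `<=` closure (multiples g) ->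
  (0 < m)%N -> A (g *+ m) -> (forall i, (0 < i < m)%N -> ~ A (g *+ i)) ->
  k != 0 -> torus_char k (Phi (g *+ m)) != 1.
Proof.
move=> As Ac [Pc Qc PD PsiA PhiA] AH m0 Am Ai k0; apply: contraNneq k0 => chi1.
have [A0 AD AN] := As.
have P0 : Phi 0 = 0 by apply: (addrI (Phi 0)); rewrite -PD// !addr0.
pose B := [set z | A z /\ torus_char k (Phi z) = 1].
have char0 : torus_char k 0 = 1.
  by rewrite -to_torus0 torus_char_to_torus /dotp big1 ?e2pi0// => i _; rewrite !mxE mulr0.
have Bs : subgroup B.
  split; first by split; rewrite ?P0.
  - move=> z w [Az z1] [Aw w1]; split; first exact: AD.
    by rewrite PD// torus_charD z1 w1 mulr1.
  move=> z [Az z1]; split; first exact: AN.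
  have : torus_char k (Phi (z - z)) = 1 by rewrite subrr P0.
  by rewrite PD//; [rewrite torus_charD z1 mul1r|exact: AN].
have Bc : closed B.
  pose V := Phi @^-1` [set w | complex.Re (torus_char k w) = 1].
  have cV : closed (V : set (subspace A)).
    apply: preimage_closed => [z _|]; first exact: Pc.
    apply: (@preimage_closed _ _ (fun w => complex.Re (torus_char k w)) [set 1]) => [w _|].
      exact: torus_char_Re_continuous.
    exact: closed_eq.
  have /closed_subspaceP[W cW WV] := cV.
  have -> : B = W `&` A.
    rewrite WV; apply/seteqP; split=> z [].
      move=> Az z1; split=> //; have : complex.Re (torus_char k (Phi z)) = 1 by rewrite z1.
      exact.
    by move=> /= Vz Az; split => //; exact: e2pi_Re1.
  exact: closedI.
have all1 w : torus_char k w = 1.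
  have [Aw <-] := PsiA w.
  have [i im [Ai' Bi]] := closure_multiples_cosets Bs Bc m0 (conj Am chi1) (AH _ Aw).
  have Agi : A (g *+ i).
    have -> : g *+ i = Psi w - (Psi w - g *+ i) by rewrite opprB addrC subrK.
    exact: subgroupB.
  have [i0|i0] := posnP i; last by case: (Ai i); rewrite ?i0.
  by move: Bi; rewrite i0 mulr0n subr0.
apply/eqP/rowP => j; rewrite mxE; apply: contrapT => /eqP kj.
have kn0 : (k 0 j)%:~R != 0 :> R by rewrite intr_eq0.
pose w : 'rV[R]_r := (2 * (k 0 j)%:~R)^-1 *: delta_mx 0 j.
have kw : dotp (intv R k) w = 2^-1.
  rewrite /dotp (bigD1 j)//= big1 ?addr0 => [|i ij]; last by rewrite !mxE (negPf ij) andbF !mulr0.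
  by rewrite !mxE !eqxx mulr1; field.
have := all1 (to_torus w); rewrite torus_char_to_torus kw /e2pi mulrAC divff// mul1r cospi.
by move=> [] /eqP; rewrite -subr_eq0 -opprD oppr_eq0 (_ : 1 + 1 = 2%:R)// pnatr_eq0.
Qed.

End DenseCharacter.

(** * The logarithm of the Zak transform on a coset *)

Section SmoothPeriodic.
Variables (R : realType) (n r : nat).
Implicit Types (G : 'rV[R]_n -> R).

(** Finite-difference form of: [G] is smooth with bounded derivatives. *)
Definition smooth_differences G : Prop := forall N, exists C, forall u a,
  `|a| <= 1 -> sdiff_bounded N C `|a| (fun i => G (u + a *+ i)).

Lemma smooth_differences_continuous G : smooth_differences G -> continuous G.
Proof.
move=> GS u; have [C GC] := GS 1%N.
apply: (@lipschitz_rV_continuous_at R _ C) => v /ltW.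
move=> uv1; have vu1 : `|v - u| <= 1 by rewrite distrC.
have := GC u (v - u) vu1 0%N 1%N isT.
by rewrite /= /sdiff mulr1n mulr0n addr0 (addrC u) subrK expr1 distrC (distrC v).
Qed.

Variables (G : 'rV[R]_n -> R) (lambda : torus R n) (Psi : torus R r -> torus R n).
Hypothesis GP : periodic_rV G.
Hypothesis GS : smooth_differences G.
Hypothesis Psic : continuous Psi.
Hypothesis PsiD : forall x y, Psi (x + y) = Psi x + Psi y.
Hypothesis Gpos : forall x, 0 < on_torus G (lambda + Psi x).

(** With [G] the square of the modulus of the Zak transform this is the logarithm
    of the modulus, lifted to the vector space. *)
Definition half_log (v : 'rV[R]_r) : R := 2^-1 * ln (on_torus G (lambda + Psi (to_torus v))).

(** A positive continuous function on a compact torus. *)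
Lemma on_torus_lower_bound : exists2 c, 0 < c & forall x, c <= on_torus G (lambda + Psi x).
Proof.
pose g (v : 'rV[R]_r) := on_torus G (lambda + Psi (to_torus v)).
have gc : continuous g.
  move=> v.
  apply: (@continuous_comp _ _ _ (fun v => lambda + Psi (to_torus v)) (on_torus G)); last first.
    by apply: on_torus_continuous => //; exact: smooth_differences_continuous.
  apply: (@continuous_comp _ _ _ (fun v => Psi (to_torus v)) (fun z => lambda + z)).
    by apply: continuous_comp; [exact: to_torus_continuous|exact: Psic].
  have := @torus_translation_continuous R n lambda (Psi (to_torus v)).
  by under eq_fun do rewrite addrC.
have cube0 : [set u : 'rV[R]_r | forall i, `[0, 1]%classic (u 0 i)] !=set0.
  by exists 0 => i /=; rewrite mxE in_itv/= lexx ler01.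
have [v _ vmin] := compact_EVT_min cube0 (@unit_cube_compact R r) (continuous_subspaceT gc).
exists (g v) => [|x]; first exact: Gpos.
have [w [k [E w01]]] := frac_rV (repr x).
have -> : x = to_torus w.
  by rewrite -(to_torus_repr x) E to_torusD to_torus_intv addr0.
apply: vmin; rewrite inE => i /=; have /andP[w0 w1] := w01 i.
by rewrite in_itv/= w0 ltW.
Qed.

Lemma half_log_periodic : periodic_rV half_log.
Proof. by move=> v k; rewrite /half_log to_torusD to_torus_intv addr0. Qed.

Lemma half_log_bounded : exists2 B, 0 <= B & forall v, `|half_log v| <= B.
Proof.
have [c c0 cG] := on_torus_lower_bound.
have [C CG] := GS 0%N; have [C' C'P] := sdiff_ln 0 C c0.
exists `|C'| => // v.
pose l := repr (lambda + Psi (to_torus v)).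
have := C'P `|0 : 'rV[R]_n| (fun i => G (l + 0 *+ i)) (normr_ge0 _).
rewrite expr0 mulr1 /= mul0rn addr0 => H.
rewrite /half_log normrM ger0_norm//.
have {}H : `|ln (on_torus G (lambda + Psi (to_torus v)))| <= C'.
  apply: H => [i|]; last by apply: CG; rewrite normr0.
  by rewrite mul0rn addr0; exact: cG.
by have := ler_norm C'; have := normr_ge0 C'; lra.
Qed.

(** Small translations lift through [Psi] to proportionally small ones, where
    [G], hence its logarithm, has good differences; for the others the bound on
    the function suffices. *)
Lemma half_log_differences N : exists C, forall v w,
  `|iter N (fdiff w) half_log v| <= C * `|w| ^+ N.
Proof.
have [c c0 cG] := on_torus_lower_bound.
have [C CG] := GS N; have [C' C'P] := sdiff_ln N C c0.
have [B B0 BP] := half_log_bounded.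
have [e [K [e0 K0 lift]]] := torus_hom_lipschitz Psic PsiD.
(* the second bound ensures that the lift has norm at most one *)
pose e1 := Num.min e (K + 1)^-1.
have K1 : 0 < K + 1 by rewrite ltr_wpDl.
have e10 : 0 < e1 by rewrite lt_min e0 invr_gt0.
exists (`|C'| * K ^+ N + B * (2 / e1) ^+ N) => v w.
have seqE : iter N (fdiff w) half_log v = iter N (@sdiff R) (fun i => half_log (v + w *+ i)) 0%N.
  by rewrite iter_fdiff_seq mulr0n addr0.
have KN : 0 <= K ^+ N by rewrite exprn_ge0.
rewrite seqE mulrDl; have [we|we] := leP `|w| e1; last first.
  have H := @sdiff_bounded_crude R N B (fun i => half_log (v + w *+ i)) B0 (fun i _ => BP _).
  apply: (le_trans (H 0%N N (leqnn N))).
  apply: (@le_trans _ _ (B * (2 / e1) ^+ N * `|w| ^+ N)).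
    rewrite -mulrA -exprMn ler_wpM2l// lerXn2r// ?nnegrE ?mulr_ge0// ?invr_ge0 ?(ltW e10)//.
    by rewrite -mulrA ler_peMr// mulrC ler_pdivlMr// mul1r ltW.
  by rewrite lerDr mulr_ge0 ?exprn_ge0// mulr_ge0.
have [a aE aw] : exists2 a, to_torus a = Psi (to_torus w) & `|a| <= K * `|w|.
  by apply: lift; apply: (le_trans we); rewrite ge_min lexx.
have a1 : `|a| <= 1.
  apply: (le_trans aw); apply: (@le_trans _ _ ((K + 1) * (K + 1)^-1)); last by rewrite divff// gt_eqF.
  apply: ler_pM => //; first by rewrite lerDl.
  by apply: (le_trans we); rewrite ge_min lexx orbT.
pose l := repr (lambda + Psi (to_torus v)).
have PsiM x i : Psi (x *+ i) = Psi x *+ i.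
  have P0 : Psi 0 = 0 by apply: (addrI (Psi 0)); rewrite -PsiD !addr0.
  by elim: i => [|i IH]; rewrite ?mulr0n// !mulrS PsiD IH.
have GE i : on_torus G (lambda + Psi (to_torus (v + w *+ i))) = G (l + a *+ i).
  rewrite -[RHS](on_torusE _ GP); congr (on_torus G _).
  by rewrite !to_torusD !to_torusMn PsiD PsiM -aE addrA to_torus_repr.
rewrite /half_log; under [X in iter _ _ X]eq_fun do rewrite GE.
rewrite iter_sdiffZ normrM ger0_norm//.
have cGl i : c <= G (l + a *+ i) by rewrite -GE cG.
have H := C'P `|a| (fun i => G (l + a *+ i)) (normr_ge0 _) cGl (CG l a a1).
have {}H : `|iter N (@sdiff R) (fun i => ln (G (l + a *+ i))) 0%N| <= `|C'| * K ^+ N * `|w| ^+ N.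
  apply: (le_trans H); apply: (@le_trans _ _ (`|C'| * `|a| ^+ N)).
    by rewrite ler_wpM2r ?exprn_ge0// ler_norm.
  by rewrite -mulrA -exprMn ler_wpM2l// lerXn2r ?nnegrE ?mulr_ge0.
apply: (@le_trans _ _ (`|C'| * K ^+ N * `|w| ^+ N)).
  by have := normr_ge0 (iter N (@sdiff R) (fun i => ln (G (l + a *+ i))) 0%N); lra.
by rewrite lerDl !mulr_ge0 ?exprn_ge0 ?divr_ge0// ltW.
Qed.

Lemma half_log_tame : tame half_log.
Proof.
split; first exact: half_log_periodic.
- have [C CP] := half_log_differences 1.
  exists C => u v; have := CP v (u - v).
  by rewrite /= /fdiff addrC subrK expr1.
by have [B _ BP] := half_log_bounded; exists B.
Qed.

End SmoothPeriodic.

Section DistanceToIntegers.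
Variable R : realType.

Lemma cmod_e2pi_le_dist_int (t : R) : cmod (e2pi t - 1) <= 4 * pi * dist_int t.
Proof.
have pi0 : 0 < 4 * pi :> R by rewrite mulr_gt0// pi_gt0.
rewrite -ler_pdivrMl//; apply: lb_le_inf.
  by exists `|t - 0%:~R|; exists 0.
move=> _ [m _ <-]; rewrite ler_pdivrMl//.
have <- : e2pi (t - m%:~R) = e2pi t.
  by rewrite e2pi_addint// rpredN intr_int.
move: (t - m%:~R) => s; apply: (le_trans (cmod_le_ReIm _)).
have c := dist_cos_le (2 * pi * s) 0; have sn := dist_sin_le (2 * pi * s) 0.
have E : `|2 * pi * s - 0| = 2 * pi * `|s| :> R.
  by rewrite subr0 normrM ger0_norm// mulr_ge0// pi_ge0.
rewrite E cos0 in c; rewrite E sin0 in sn.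
have -> : complex.Re (e2pi s - 1) = cos (2 * pi * s) - 1 by [].
have -> : complex.Im (e2pi s - 1) = sin (2 * pi * s) - 0 by [].
lra.
Qed.

End DistanceToIntegers.

Section ZakSquare.
Variables (R : realType) (d : nat) (f : 'rV[R]_d -> R[i]).
Hypothesis fS : schwartz f.

Definition zak_sqr (u : 'rV[R]_(d + d)) : R := cmod (zak f u) ^+ 2.

Lemma zak_sqr_periodic : periodic_rV zak_sqr.
Proof. by move=> u k; rewrite /zak_sqr cmod_zak_periodic. Qed.

(** Periodicity makes the bounds on the unit cube global. *)
Lemma zak_sqr_smooth : smooth_differences zak_sqr.
Proof.
move=> N; have [C CP] := zak_sdiff N fS ler01.
exists C => u a a1; have [v [k [-> v1]]] := frac_rV_norm u.
by under eq_fun do rewrite addrAC zak_sqr_periodic; exact: CP.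
Qed.

Variables (n : nat) (x y : 'I_n -> 'rV[int]_d) (c : 'I_n -> R[i]) (alpha beta : 'rV[R]_d).
Hypothesis feq : (fun t => \sum_(k < n) c k *
    modulation (intv R (y k)) (translation (intv R (x k)) f) t)
  = modulation beta (translation alpha f).
Let gamma := row_mx (- alpha) beta.

Lemma zak_sqr_step u : zak_sqr (u + gamma) = cmod (trigp x y c u) ^+ 2 * zak_sqr u.
Proof. by rewrite /zak_sqr (zak_functional_equation u fS feq) exprMn. Qed.

Lemma trigQ_ge0 m z : 0 <= trigQ x y c gamma m z.
Proof. by apply: prodr_ge0 => j _; exact: cmod_ge0. Qed.

Lemma zak_sqr_iterate m (z : torus R (d + d)) :
  on_torus zak_sqr (z + to_torus gamma *+ m) =
  trigQ x y c gamma m z ^+ 2 * on_torus zak_sqr z.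
Proof.
elim: m => [|m IH]; first by rewrite mulr0n addr0 /trigQ big_ord0 expr1n mul1r.
rewrite mulrSr addrA /trigQ big_ord_recr/= exprMn mulrAC -/(trigQ x y c gamma m z) -IH.
rewrite to_torusMn; set w := z + to_torus gamma *+ m.
rewrite -[in LHS](to_torus_repr w) -to_torusD on_torusE; last exact: zak_sqr_periodic.
by rewrite zak_sqr_step mulrC.
Qed.

(** The zero set is stable under [closure (multiples gamma)], a group: a zero at
    [lambda + h] would give one at [lambda]. *)
Lemma zak_sqr_orbit_neq0 (lambda h : torus R (d + d)) :
  closure (multiples (to_torus gamma)) h ->
  on_torus zak_sqr lambda != 0 -> on_torus zak_sqr (lambda + h) != 0.
Proof.
move=> Hh; apply: contra_neq => lh0.
have [_ _ HN] := subgroup_closure (subgroup_multiples (to_torus gamma)).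
have E : multiples (to_torus gamma) = [set to_torus (gamma *~ i) | i in [set: int]].
  by apply/seteqP; split=> _ [i _ <-]; exists i; rewrite ?to_torusMz.
have := @zero_set_invariant R (d + d) zak_sqr gamma (repr (lambda + h)) zak_sqr_periodic
  (smooth_differences_continuous zak_sqr_smooth) _ _ (- h).
rewrite -E to_torus_repr addrK; apply.
- by move=> v v0; rewrite zak_sqr_step v0 mulr0.
- exact: lh0.
exact: HN.
Qed.

End ZakSquare.

(** * Decay of the quotients *)

Theorem proposition5p2 (R : realType) (d L : nat)
    (d_ge1 : (1 <= d)%N) (L_ge2 : (2 <= L)%N)
    (x y : 'I_L.-1 -> 'rV[int]_d) (alpha beta : 'rV[R]_d)
    (alphabeta_nonint :
       ~ (alpha \in intvec (R := R) (n := d) /\ beta \in intvec (R := R) (n := d)))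
    (f : 'rV[R]_d -> R[i]) (c : 'I_L.-1 -> R[i])
    (f_schwartz : schwartz f) (f_neq0 : f <> (fun=> 0))
    (f_eq : (fun t => \sum_(k < L.-1) c k *
                modulation (intv R (y k)) (translation (intv R (x k)) f) t)
            = modulation beta (translation alpha f)) :
  let gamma : 'rV[R]_(d + d) := row_mx (- alpha) beta in
  let H : set (torus R (d + d)) :=
    closure [set to_torus (gamma *~ n) | n in [set: int]] in
  forall (H_infinite : infinite_set H) (H_proper : H <> setT),
  let H0 : set (torus R (d + d)) := connected_component H 0 in
  forall (m : nat) (m_card : (cosets H H0 #= `I_m)%card)
         (r : nat) (Phi : torus R (d + d) -> torus R r)
         (Psi : torus R r -> torus R (d + d))
         (Phi_iso : torus_iso H0 Phi Psi),
  let omega : torus R r := Phi (to_torus (gamma *+ m)) in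
  forall (lambda : torus R (d + d)) (lambda_S : zak_support f lambda),
  let b : torus R r -> R :=
    fun z => ln (trigQ x y c gamma m (lambda + Psi z)) in
  let bhat : 'rV[int]_r -> R[i] := fourier_coef (fun z => (b z)%:C) in
  [/\ (* the logarithm and the quotients below are well defined *)
      (forall z : torus R r, 0 < trigQ x y c gamma m (lambda + Psi z)) /\
      (forall k : 'rV[int]_r, k != 0 ->
         cmod (e2pi (tpair k omega) - 1) != 0 /\
         dist_int (tpair k omega) != 0),
      (forall N : nat,
         (ereal_sup [set ((1 + eucl_norm (intv R k)) ^+ N
                          * (cmod (bhat k) / cmod (e2pi (tpair k omega) - 1)))%:E
                    | k in [set k : 'rV[int]_r | k != 0%R]] < +oo)%E),
      (forall N : nat,
         (ereal_sup [set ((1 + eucl_norm (intv R k)) ^+ N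
                          * (cmod (bhat k) / dist_int (tpair k omega)))%:E
                    | k in [set k : 'rV[int]_r | k != 0%R]] < +oo)%E) &
      ~ (exists (N : nat) (k_ : nat -> 'rV[int]_r),
           (forall n, k_ n != 0) /\
           (1 + eucl_norm (intv R (k_ n))) ^+ N
             * (cmod (bhat (k_ n)) / dist_int (tpair (k_ n) omega))
             @[n --> \oo] --> +oo)].
Proof.
move=> gamma H H_infinite H_proper H0 m m_card r Phi Psi Phi_iso omega lambda lambda_S b bhat.
pose g : torus R (d + d) := to_torus gamma.
have HE : H = closure (multiples g).
  congr closure; apply/seteqP; split=> _ [i _ <-]; exists i => //.
    by rewrite -to_torusMz.
  by rewrite to_torusMz.
have Hs : subgroup H by rewrite HE; apply: subgroup_closure; exact: subgroup_multiples.
have H0s : subgroup H0 by exact: subgroup_component.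
have H0c : closed H0 by apply: component_closed; exact: closed_closure.
have H0H : H0 `<=` H by exact: connected_component_sub.
have [m0 H0m H0i] : [/\ (0 < m)%N, H0 (g *+ m) & forall i, (0 < i < m)%N -> ~ H0 (g *+ i)].
  by apply: cosets_multiples; rewrite -?HE.
have [Phic Psic PhiD PsiH0 PhiK] := Phi_iso.
have [_ H0D _] := H0s.
have PsiD z w : Psi (z + w) = Psi z + Psi w.
  have [Az Ez] := PsiH0 z; have [Aw Ew] := PsiH0 w.
  by rewrite -{1}Ez -{1}Ew -PhiD// PhiK//; exact: H0D.
have Psi_omega : Psi omega = g *+ m by rewrite /omega to_torusMn PhiK.
have Gpos h : H h -> 0 < on_torus (zak_sqr f) (lambda + h).
  move=> Hh; rewrite lt_neqAle eq_sym; apply/andP; split; last exact: sqr_ge0.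
  apply: (zak_sqr_orbit_neq0 f_schwartz f_eq); first by rewrite -HE.
  by rewrite expf_eq0/=; apply/eqP.
have GPsi z : 0 < on_torus (zak_sqr f) (lambda + Psi z).
  by apply: Gpos; apply: H0H; case: (PsiH0 z).
have Qsqr z : on_torus (zak_sqr f) (lambda + Psi (z + omega)) =
    trigQ x y c gamma m (lambda + Psi z) ^+ 2 * on_torus (zak_sqr f) (lambda + Psi z).
  by rewrite PsiD Psi_omega addrA (zak_sqr_iterate f_schwartz f_eq).
have Qpos z : 0 < trigQ x y c gamma m (lambda + Psi z).
  rewrite lt_neqAle trigQ_ge0 andbT eq_sym; apply/eqP => Q0.
  by have := GPsi (z + omega); rewrite Qsqr Q0 expr0n mul0r ltxx.
have GS := zak_sqr_smooth f_schwartz.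
have GP := zak_sqr_periodic f_schwartz.
pose u := half_log (zak_sqr f) lambda Psi.
have ut : tame u by exact: half_log_tame.
pose w := repr omega.
(* [b] is the coboundary of [u] along the translation by [omega] *)
have bE v : b (to_torus v) = u (v + w) - u v.
  rewrite /u /half_log to_torusD to_torus_repr Qsqr.
  rewrite /b; move: (trigQ _ _ _ _ _ _) (Qpos (to_torus v)) (on_torus _ _) (GPsi (to_torus v)) => q q0 p p0.
  by rewrite expr2 lnM ?posrE ?mulr_gt0// lnM ?posrE//; lra.
have bhatE k : bhat k = (e2pi (tpair k omega) - 1) * cube_fourier k u.
  transitivity (cube_fourier k (fun v => u (v + w) - u v)).
    by congr ccube_integral; apply/funext => v; rewrite -bE.
  rewrite (cube_fourierB k (tame_shift w ut) ut).
  by rewrite (cube_fourier_shift k w ut) mulrBl mul1r.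
have e_neq0 k : k != 0 -> 0 < cmod (e2pi (tpair k omega) - 1).
  move=> k0; rewrite lt_neqAle cmod_ge0 andbT eq_sym.
  apply/eqP => /Normc.eq0_normc /eqP; rewrite subr_eq0; apply/negP.
  have := torus_char_neq1 H0s H0c Phi_iso _ m0 H0m H0i k0.
  by rewrite -HE /torus_char /omega to_torusMn; apply.
have pi0 : 0 < 4 * pi :> R by rewrite mulr_gt0// pi_gt0.
have d_gt0 k : k != 0 -> 0 < dist_int (tpair k omega).
  move=> k0; rewrite -(pmulr_rgt0 _ pi0).
  exact: lt_le_trans (e_neq0 k k0) (cmod_e2pi_le_dist_int _).
have decay := fourier_decay ut (half_log_differences GP GS Psic PsiD GPsi).
have ratio1 k : k != 0 -> cmod (bhat k) / cmod (e2pi (tpair k omega) - 1) = cmod (cube_fourier k u).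
  by move=> k0; rewrite bhatE cmodM mulrAC divff ?mul1r// gt_eqF// e_neq0.
have ratio2 k : k != 0 -> cmod (bhat k) / dist_int (tpair k omega) <= 4 * pi * cmod (cube_fourier k u).
  move=> k0; rewrite ler_pdivrMr ?d_gt0// bhatE cmodM mulrAC ler_wpM2r ?cmod_ge0//.
  exact: cmod_e2pi_le_dist_int.
have bound N : exists C, forall k, k != 0 ->
    (1 + eucl_norm (intv R k)) ^+ N * (cmod (bhat k) / dist_int (tpair k omega)) <= C.
  have [C CP] := decay N; exists (4 * pi * C) => k k0.
  apply: (@le_trans _ _ (4 * pi * ((1 + eucl_norm (intv R k)) ^+ N * cmod (cube_fourier k u)))).
    by rewrite [leRHS]mulrCA ler_wpM2l ?ratio2// exprn_ge0// addr_ge0// sqrtr_ge0.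
  by rewrite ler_wpM2l ?CP// ltW.
split.
- split=> // k k0; split; first by rewrite gt_eqF ?e_neq0.
  by rewrite gt_eqF ?d_gt0.
- move=> N; have [C CP] := decay N.
  apply: (@le_lt_trans _ _ C%:E); last exact: ltry.
  by apply: ge_ereal_sup => _ [k k0 <-]; rewrite lee_fin ratio1// CP.
- move=> N; have [C CP] := bound N.
  apply: (@le_lt_trans _ _ C%:E); last exact: ltry.
  by apply: ge_ereal_sup => _ [k k0 <-]; rewrite lee_fin CP.
move=> [N [k_ [k0 /cvgryPge kc]]]; have [C CP] := bound N.
have [n _ /(_ n (leqnn n)) Cn] := kc (C + 1).
by have := le_trans Cn (CP _ (k0 n)); rewrite gerDl ler10.
Qed.
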